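(* Let $\Bbbk$ be a field, let $R$ be a noetherian commutative $\Bbbk$-algebra, and let $G$ be a nontrivial finite group with $\operatorname{char}\Bbbk\nmid|G|$ acting on $R$ by automorphisms. Let $\mathfrak r=\mathfrak r(R,G)$ be the $G$-radical of $R$, $A=R^G$, $\mathfrak a=A\cap\mathfrak r$, $B=R*G$ the skew group algebra and $\mathfrak b=\mathfrak r\otimes\Bbbk G\subseteq B$. Then the following are equivalent. (i) The functor $-\otimes_{\mathcal B}\mathcal R:\operatorname{QMod}_{\mathfrak b}B\to\operatorname{QMod}_{\mathfrak a}A$ is an equivalence of abelian categories. (ii) The ideal $\mathfrak a$ of $A$ and the ideal $\mathfrak r$ of $R$ are cofinal.
   Context: $R^G$ is the subalgebra of invariants. The skew group algebra $R*G$ is $R\otimes\Bbbk G$ with $(r\otimes g)(s\otimes h)=r(g\cdot s)\otimes gh$. Pertinent sequences and $G$-radical: sequences $(a_1,\dots,a_n)$, $(b_1,\dots,b_n)$ in $R$ are pertinent under the $G$-action if $\sum_{i}a_i(g\cdot b_i)=0$ for all $1\ne g\in G$. The $G$-radical is the ideal $\mathfrak r(R,G)=\{\sum_{i=1}^n a_ib_i : n\ge 1,\ (a_1,\dots,a_n),(b_1,\dots,b_n)\text{ pertinent under the }G\text{-action}\}$ of $R$; it is $G$-stable, so $\mathfrak b$ is an ideal of $B$. Cofinal: $\mathfrak a$ and $\mathfrak r$ are cofinal if (i) $\mathfrak aR=R\mathfrak a$ (automatic for commutative $R$), and (ii) for each $s$ there is an integer $n$ with $\mathfrak r^n\subseteq\mathfrak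 a^sR$. Quotient categories: for an ideal $\mathfrak s$ of a noetherian algebra $S$, $\operatorname{Mod}S$ is the category of right $S$-modules, $\Gamma_{\mathfrak s}=\varinjlim_n\operatorname{Hom}_S(S/\mathfrak s^n,-)$, a right module $M$ is $\mathfrak s$-torsion if $\Gamma_{\mathfrak s}(M)=M$, $\operatorname{Tor}_{\mathfrak s}S$ is the (localizing) full subcategory of $\mathfrak s$-torsion modules, and $\operatorname{QMod}_{\mathfrak s}S=\operatorname{Mod}S/\operatorname{Tor}_{\mathfrak s}S$ is the Serre quotient, with projection functor $\pi$; $\mathcal M=\pi(M)$. Functor: $R$ is a $B$-$A$-bimodule via $(r\otimes g)\cdot x=r(g\cdot x)$ and right multiplication by $A$. The exact functor $-\otimes_BR:\operatorname{Mod}B\to\operatorname{Mod}A$ sends $\mathfrak b$-torsion modules to $\mathfrak a$-torsion modules and so induces an exact functor $-\otimes_{\mathcal B}\mathcal R:\operatorname{QMod}_{\mathfrak b}B\to\operatorname{QMod}_{\mathfrak a}A$, $\pi(M)\mapsto\pi(M\otimes_BR)$. *)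

(* Defs.v *)
From HB Require Import structures.
From mathcomp Require Import all_boot all_order all_fingroup all_algebra.
From mathcomp Require Import generic_quotient boolp.

Set Implicit Arguments.
Unset Strict Implicit.
Unset Printing Implicit Defensive.

Import GRing.Theory.
Local Open Scope ring_scope.

(* Categories whose hom-sets carry an equivalence relation [heq], which plays
   the role of equality of morphisms. *)

Record category := Category {
  obj :> Type;
  hom : obj -> obj -> Type;
  heq : forall X Y, hom X Y -> hom X Y -> Prop;
  idm : forall X, hom X X;
  comp : forall X Y Z, hom X Y -> hom Y Z -> hom X Z; (* diagrammatic order *)
  heq_refl : forall X Y (f : hom X Y), heq f f;
  heq_sym : forall X Y (f g : hom X Y), heq f g -> heq g f;
  heq_trans : forall X Y (f g h : hom X Y), heq f g -> heq g h -> heq f h;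
  comp_heq : forall X Y Z (f f' : hom X Y) (g g' : hom Y Z),
    heq f f' -> heq g g' -> heq (comp f g) (comp f' g');
  comp1m : forall X Y (f : hom X Y), heq (comp (idm X) f) f;
  compm1 : forall X Y (f : hom X Y), heq (comp f (idm Y)) f;
  compA : forall W X Y Z (f : hom W X) (g : hom X Y) (h : hom Y Z),
    heq (comp f (comp g h)) (comp (comp f g) h)
}.
Arguments idm {c} X.
Arguments comp {c X Y Z} _ _.

Record functor (C D : category) := Functor {
  fobj :> C -> D;
  fmap : forall X Y, hom X Y -> hom (fobj X) (fobj Y);
  fmap_heq : forall X Y (f g : hom X Y), heq f g -> heq (fmap f) (fmap g);
  fmap1 : forall X, heq (fmap (idm X)) (idm (fobj X));
  fmapM : forall X Y Z (f : hom X Y) (g : hom Y Z),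
    heq (fmap (comp f g)) (comp (fmap f) (fmap g))
}.
Arguments fmap {C D} _ {X Y} _.

Section FunctorOperations.
Variables C D E : category.

Definition functor_id : functor C C.
Proof.
refine (@Functor C C id (fun _ _ f => f) _ _ _) => // *; exact: heq_refl.
Defined.

Definition functor_comp (F : functor C D) (G : functor D E) : functor C E.
Proof.
refine (@Functor C E (fun X => G (F X)) (fun _ _ f => fmap G (fmap F f)) _ _ _).
- by move=> X Y f g fg; apply/fmap_heq/fmap_heq.
- by move=> X; apply: heq_trans (fmap1 _ _); apply/fmap_heq/fmap1.
- by move=> X Y Z f g; apply: heq_trans (fmapM _ _ _); apply/fmap_heq/fmapM.
Defined.

Definition nat_iso (F G : functor C D) : Prop :=
  exists (a : forall X, hom (F X) (G X)) (b : forall X, hom (G X) (F X)),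
    [/\ forall X Y (f : hom X Y),
          heq (comp (fmap F f) (a Y)) (comp (a X) (fmap G f)),
        forall X, heq (comp (a X) (b X)) (idm (F X))
      & forall X, heq (comp (b X) (a X)) (idm (G X))].

End FunctorOperations.

Definition is_equivalence (C D : category) (F : functor C D) : Prop :=
  exists G : functor D C,
    nat_iso (functor_comp F G) (functor_id C) /\
    nat_iso (functor_comp G F) (functor_id D).

Section Ideals.
Variable S : pzRingType.
Implicit Types I J K : S -> Prop.

Definition right_ideal I : Prop :=
  [/\ I 0, forall x y, I x -> I y -> I (x + y) & forall x y, I x -> I (x * y)].

Definition ideal I : Prop :=
  [/\ I 0, forall x y, I x -> I y -> I (x + y),
      forall x y, I x -> I (x * y) & forall x y, I y -> I (x * y)].

Definition right_noetherian : Prop :=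
  forall I, right_ideal I ->
  exists s : seq S, {in s, forall u, I u} /\
    forall x, I x -> exists c : S -> S, x = \sum_(u <- s) u * c u.

Definition idealM I J : S -> Prop := fun x =>
  exists s : seq (S * S),
    {in s, forall p, I p.1 /\ J p.2} /\ x = \sum_(p <- s) p.1 * p.2.

Fixpoint idealX I (n : nat) : S -> Prop :=
  if n is n'.+1 then idealM (idealX I n') I else fun=> True.

Lemma idealM_add I J x y : idealM I J x -> idealM I J y -> idealM I J (x + y).
Proof.
move=> [s [sP ->]] [t [tP ->]]; exists (s ++ t); rewrite big_cat; split=> // p.
by rewrite mem_cat => /orP[/sP|/tP].
Qed.

Lemma idealM0 I J : idealM I J 0.
Proof. by exists [::]; rewrite big_nil. Qed.

Lemma idealM_mul I J x y : I x -> J y -> idealM I J (x * y).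
Proof.
move=> Ix Jy; exists [:: (x, y)]; rewrite big_seq1; split=> // p.
by rewrite inE => /eqP->.
Qed.

Lemma idealM_ind I J (P : S -> Prop) :
  P 0 -> (forall x y, P x -> P y -> P (x + y)) ->
  (forall x y, I x -> J y -> P (x * y)) -> forall x, idealM I J x -> P x.
Proof.
move=> P0 PD PM x [s [sP ->]]; rewrite big_seq.
by apply: big_ind => // p /sP[? ?]; apply: PM.
Qed.

Lemma idealM_ideal I J : ideal I -> ideal J -> ideal (idealM I J).
Proof.
move=> [_ _ _ Il] [_ _ Jr _]; split; first exact: idealM0.
- exact: idealM_add.
- move=> x y; move: x; apply: idealM_ind => [|u v ? ?|u v ? ?].
  + by rewrite mul0r; apply: idealM0.
  + by rewrite mulrDl; apply: idealM_add.
  + by rewrite -mulrA; apply: idealM_mul => //; apply: Jr.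
- move=> x; apply: idealM_ind => [|u v ? ?|u v ? ?].
  + by rewrite mulr0; apply: idealM0.
  + by rewrite mulrDr; apply: idealM_add.
  + by rewrite mulrA; apply: idealM_mul => //; apply: Il.
Qed.

Lemma idealX_ideal I n : ideal I -> ideal (idealX I n).
Proof. by move=> hI; elim: n => //= n IHn; apply: idealM_ideal. Qed.

Lemma idealX_anti I m n x : ideal I -> (m <= n)%N -> idealX I n x -> idealX I m x.
Proof.
move=> hI; elim: n x => [|n IHn] x; first by rewrite leqn0 => /eqP->.
rewrite leq_eqVlt => /predU1P[-> //|]; rewrite ltnS => le_mn h.
apply: IHn => //; move: x h => /=; have [h0 hD hr _] := idealX_ideal n hI.
by apply: idealM_ind => // u v /hr.
Qed.

Lemma idealX_add I m n x :
  idealX I (m + n) x -> idealM (idealX I m) (idealX I n) x.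
Proof.
elim: n x => [|n IHn] x.
  by rewrite addn0 -{2}[x]mulr1 => h; apply: idealM_mul.
rewrite addnS /=; move: x; apply: idealM_ind; first exact: idealM0.
  exact: idealM_add.
move=> x y /IHn + Iy; move: x; apply: idealM_ind.
- by rewrite mul0r; apply: idealM0.
- by move=> *; rewrite mulrDl; apply: idealM_add.
- by move=> u v ? ?; rewrite -mulrA; apply: idealM_mul => //; apply: idealM_mul.
Qed.

End Ideals.

Lemma idealX_morph (S T : pzRingType) (f : {rmorphism S -> T})
    (I : S -> Prop) (J : T -> Prop) n x :
  (forall y, I y -> J (f y)) -> idealX I n x -> idealX J n (f x).
Proof.
move=> IJ; elim: n x => //= n IHn; apply: idealM_ind.
- by rewrite rmorph0; apply: idealM0.
- by move=> *; rewrite rmorphD; apply: idealM_add.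
- by move=> u v /IHn ? /IJ ?; rewrite rmorphM; apply: idealM_mul.
Qed.

(* Right S-modules are left modules over the converse ring S^c. *)

Notation rmodType S := (lmodType S^c).

Section RightAction.
Variables (S : pzRingType) (M : rmodType S).

Definition ract (m : M) (x : S) : M := (x : S^c) *: m.

Lemma ractDl m n x : ract (m + n) x = ract m x + ract n x.
Proof. exact: scalerDr. Qed.
Lemma ractDr m x y : ract m (x + y) = ract m x + ract m y.
Proof. exact: scalerDl. Qed.
Lemma ract0l x : ract 0 x = 0. Proof. exact: scaler0. Qed.
Lemma ract0r m : ract m 0 = 0. Proof. exact: scale0r. Qed.
Lemma ractN m x : ract (- m) x = - ract m x. Proof. exact: scalerN. Qed.
Lemma ract1 m : ract m 1 = m. Proof. exact: scale1r. Qed.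
Lemma ractA m x y : ract (ract m x) y = ract m (x * y).
Proof. exact: scalerA. Qed.
Lemma ractN1 m : ract m (-1) = - m. Proof. exact: scaleN1r. Qed.
Lemma ract_sumr (I : Type) (s : seq I) (c : I -> S) m :
  ract m (\sum_(i <- s) c i) = \sum_(i <- s) ract m (c i).
Proof. exact: scaler_suml. Qed.

Definition submodule (P : M -> Prop) : Prop :=
  [/\ P 0, forall m n, P m -> P n -> P (m + n) & forall m x, P m -> P (ract m x)].

End RightAction.

Definition Mod (S : pzRingType) : category.
Proof.
refine (@Category (rmodType S) (fun M N => {linear M -> N}) (fun M N f g => f =1 g)
  (fun M => idfun : {linear M -> M}) (fun M N P f g => g \o f : {linear _ -> _})
  _ _ _ _ _ _ _) => //.
- by move=> X Y f g fg x; rewrite fg.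
- by move=> X Y f g h fg gh x; rewrite fg.
- by move=> X Y Z f f' g g' ff' gg' x /=; rewrite ff' gg'.
Defined.

Section Torsion.
Variables (S : pzRingType) (s : S -> Prop).
Hypotheses (hs : ideal s) (noeS : right_noetherian S).

Section Eventually.
Variable M : rmodType S.

(* Evaluation at the class of 1 identifies Hom_S(S/s^n, M) with
   {m | m s^n = 0}, so these are the elements of Gamma_s(M). *)
Definition torsion (m : M) : Prop :=
  exists n, forall x, idealX s n x -> ract m x = 0.

(* The class of m in M/P is s-torsion. *)
Definition torsion_mod (P : M -> Prop) (m : M) : Prop :=
  exists n, forall x, idealX s n x -> P (ract m x).

Lemma torsion_modW (P Q : M -> Prop) m :
  (forall n, P n -> Q n) -> torsion_mod P m -> torsion_mod Q m.
Proof. by move=> PQ [k h]; exists k => x /h/PQ. Qed.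

Lemma torsion_mod_sub (P : M -> Prop) m : submodule P -> P m -> torsion_mod P m.
Proof. by move=> [_ _ Pr] Pm; exists 0 => x _; apply: Pr. Qed.

Lemma torsion_modI (P Q : M -> Prop) m :
  torsion_mod P m -> torsion_mod Q m -> torsion_mod (fun n => P n /\ Q n) m.
Proof.
move=> [k hk] [l hl]; exists (maxn k l) => x hx; split.
  by apply/hk/(idealX_anti hs (leq_maxl k l)).
by apply/hl/(idealX_anti hs (leq_maxr k l)).
Qed.

Lemma torsion_mod_trans (P : M -> Prop) m :
  submodule P -> torsion_mod (torsion_mod P) m -> torsion_mod P m.
Proof.
move=> [P0 PD _] [k hk].
have [hr0 hrD hrr _] := idealX_ideal k hs.
have [|u [uP uS]] := noeS (I := idealX s k); first by split.
have [K hK] : exists K, {in u, forall a, forall y, idealX s K y ->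
    P (ract (ract m a) y)}.
  elim: u uP {uS} => [|a u IHu] uP; first by exists 0.
  have [K1 h1] := IHu (fun b bu => uP b (mem_behead (s := a :: u) bu)).
  have [K2 h2] := hk _ (uP a (mem_head a u)).
  exists (maxn K1 K2) => b; rewrite inE => /predU1P[->|bu] y hy.
    by apply/h2/(idealX_anti hs (leq_maxr K1 K2)).
  by apply/h1/(idealX_anti hs (leq_maxl K1 K2)).
exists (k + K)%N => z /idealX_add; move: z; apply: idealM_ind.
- by rewrite ract0r.
- by move=> x y; rewrite ractDr; apply: PD.
move=> x y /uS[c ->] hy; rewrite mulr_suml ract_sumr big_seq.
apply: big_ind => // a au; rewrite -mulrA -ractA; apply: hK => //.
by have [_ _ _ hl] := idealX_ideal K hs; apply: hl.
Qed.

Lemma torsion_submod : submodule torsion.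
Proof.
split.
- by exists 0 => x _; rewrite ract0l.
- move=> m n [k1 h1] [k2 h2].
  exists (maxn k1 k2) => x hx; rewrite ractDl h1 ?h2 ?addr0 //.
    exact: idealX_anti (leq_maxr _ _) hx.
  exact: idealX_anti (leq_maxl _ _) hx.
- move=> m y [k hk]; exists k => x hx; rewrite ractA; apply: hk.
  by have [_ _ _ hl] := idealX_ideal k hs; apply: hl.
Qed.

Lemma torsion_trans m : torsion_mod torsion m -> torsion m.
Proof.
apply: (@torsion_mod_trans (fun n => n = 0)); split=> // [? ? -> ->|? ? ->].
  by rewrite addr0.
by rewrite ract0l.
Qed.

Lemma torsionB m n : torsion m -> torsion n -> torsion (m - n).
Proof.
have [_ tD tr] := torsion_submod => tm tn.
by apply: tD; rewrite // -ractN1; apply: tr.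
Qed.

End Eventually.

(* Morphisms pi(M) -> pi(N) in the Serre quotient: by Gabriel's construction,
   Hom(pi M, pi N) is the colimit of Hom_S(M', N/N') over the submodules M' of M
   and N' of N such that M/M' and N' are s-torsion.  A triple
   (M', N', f : M' -> N/N') is recorded by the submodule
   {(m, n) | m \in M' and n \in f(m)} of M x N, from which it is recovered as
   M' = {m | exists n, (m, n)} and N' = {n | (0, n)}. *)

Record qhom (M N : rmodType S) := QHom {
  qrel :> M -> N -> Prop;
  qrel0 : qrel 0 0;
  qrelD : forall m m' n n', qrel m n -> qrel m' n' -> qrel (m + m') (n + n');
  qrelZ : forall m n x, qrel m n -> qrel (ract m x) (ract n x);
  qrel_dom : forall m, torsion_mod (fun m' => exists n, qrel m' n) m;
  qrel_ker : forall n, qrel 0 n -> torsion n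
}.

(* Equality in the colimit: the two maps induce the same map M'' -> N/N'' for
   some smaller M'' and larger N'' in the index set. *)
Definition qeq (M N : rmodType S) (f g : qhom M N) : Prop :=
  exists (M'' : M -> Prop) (N'' : N -> Prop),
  [/\ submodule M'' /\ (forall m, torsion_mod M'' m),
      submodule N'' /\ (forall n, N'' n -> torsion n),
      forall m, M'' m -> (exists n, f m n) /\ (exists n, g m n),
      forall n, f 0 n \/ g 0 n -> N'' n
    & forall m n n', M'' m -> f m n -> g m n' -> N'' (n - n')].

Section QHomTheory.
Variables M N : rmodType S.
Implicit Types f g h : qhom M N.

Lemma qrelB f m m' n n' : f m n -> f m' n' -> f (m - m') (n - n').
Proof. by move=> h /(qrelZ (-1)); rewrite !ractN1; apply: qrelD. Qed.

Lemma qrel_dom_sub f : submodule (fun m => exists n, f m n).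
Proof.
split; first by exists 0; apply: qrel0.
- by move=> m m' [n h] [n' h']; exists (n + n'); apply: qrelD.
- by move=> m x [n h]; exists (ract n x); apply: qrelZ.
Qed.

Lemma qrel_fun f m n n' : f m n -> f m n' -> torsion (n - n').
Proof. by move=> h h'; apply: (@qrel_ker _ _ f); rewrite -(subrr m); apply: qrelB. Qed.

Lemma qeqP f g :
  qeq f g <-> forall m n n', f m n -> g m n' -> torsion (n - n').
Proof.
split=> [[M'' [N'' [[_ dM] [_ tN] _ _ fg]]] m n n' fmn gmn'|fg].
  apply: torsion_trans; have [k hk] := dM m; exists k => x hx; apply: tN.
  rewrite ractDl ractN; apply: (fg (ract m x)); first exact: hk.
    exact: qrelZ.
  exact: qrelZ.
exists (fun m => (exists n, f m n) /\ (exists n, g m n)), (@torsion N); split.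
- split; last by move=> m; apply: torsion_modI; apply: qrel_dom.
  have [f0 fD fr] := qrel_dom_sub f; have [g0 gD gr] := qrel_dom_sub g.
  split=> [|m m' [? ?] [? ?]|m x [? ?]]; first by split.
    by split; [apply: fD | apply: gD].
  by split; [apply: fr | apply: gr].
- by split; first exact: torsion_submod.
- by [].
- by move=> n [] /qrel_ker.
- by move=> m n n' _; apply: fg.
Qed.

Lemma qeq_refl f : qeq f f.
Proof. by apply/qeqP => m n n'; apply: qrel_fun. Qed.

Lemma qeq_sym f g : qeq f g -> qeq g f.
Proof.
move=> /qeqP fg; apply/qeqP => m n n' h h'; rewrite -opprB -ractN1.
by have [_ _ tr] := torsion_submod N; apply/tr/(fg m).
Qed.

Lemma qeq_trans f g h : qeq f g -> qeq g h -> qeq f h.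
Proof.
move=> /qeqP fg /qeqP gh; apply/qeqP => m n n' fmn hmn'.
apply: torsion_trans; have [k hk] := qrel_dom g m; exists k => x /hk[p gp].
have [_ tD _] := torsion_submod N.
rewrite ractDl ractN -(subrKA p); apply: tD.
  by apply: (fg (ract m x)) => //; apply: qrelZ.
by apply: (gh (ract m x)) => //; apply: qrelZ.
Qed.

End QHomTheory.

Section QOperations.
Variables M N P : rmodType S.

Definition qlin (f : {linear M -> N}) : qhom M N.
Proof.
exists (fun m n => n = f m).
- by rewrite raddf0.
- by move=> m m' n n' -> ->; rewrite raddfD.
- by move=> m n x ->; rewrite /ract linearZ.
- by move=> m; exists 0 => x _; exists (f (ract m x)).
- by move=> n ->; rewrite raddf0; have [] := torsion_submod N.
Defined.

Definition qcomp (f : qhom M N) (g : qhom N P) : qhom M P.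
Proof.
exists (fun m p => exists n, f m n /\ g n p).
- by exists 0; split; apply: qrel0.
- move=> m m' p p' [n [h1 h2]] [n' [h1' h2']]; exists (n + n').
  by split; apply: qrelD.
- by move=> m p x [n [h1 h2]]; exists (ract n x); split; apply: qrelZ.
- move=> m; apply: torsion_mod_trans.
    split; first by exists 0, 0; split; apply: qrel0.
      move=> m1 m2 [p1 [n1 [? ?]]] [p2 [n2 [? ?]]].
      by exists (p1 + p2), (n1 + n2); split; apply: qrelD.
    by move=> m1 x [p1 [n1 [? ?]]]; exists (ract p1 x), (ract n1 x); split; apply: qrelZ.
  apply: torsion_modW (qrel_dom f m) => {}m [n fmn].
  have [k hk] := qrel_dom g n; exists k => x /hk[p gp].
  by exists p, (ract n x); split=> //; apply: qrelZ.
- move=> p [n [/qrel_ker [k hk] gnp]]; apply: torsion_trans.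
  by exists k => x hx; apply: (@qrel_ker _ _ g); rewrite -(hk x hx); apply: qrelZ.
Defined.

End QOperations.

Lemma qcomp_qeq (M N P : rmodType S) (f f' : qhom M N) (g g' : qhom N P) :
  qeq f f' -> qeq g g' -> qeq (qcomp f g) (qcomp f' g').
Proof.
move=> /qeqP ff' /qeqP gg'; apply/qeqP => m p p' [n [fn gp]] [n' [fn' gp']].
have [k hk] := ff' _ _ _ fn fn'; apply: torsion_trans; exists k => x hx.
have /eqP := hk x hx; rewrite ractDl ractN subr_eq0 => /eqP nx.
rewrite ractDl ractN; apply: (gg' (ract n x)); first exact: qrelZ.
by rewrite nx; apply: qrelZ.
Qed.

Definition QMod : category.
Proof.
refine (@Category (rmodType S) qhom qeq (fun M => qlin (idfun : {linear M -> M}))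
  qcomp qeq_refl qeq_sym qeq_trans qcomp_qeq _ _ _).
- move=> M N f; apply/qeqP => m n n' [_ [-> h]]; exact: qrel_fun h.
- move=> M N f; apply/qeqP => m n n' [p [h ->]]; exact: qrel_fun h.
- move=> M N P Q f g h; apply/qeqP => m q q' [n [h1 [p [h2 h3]]]] h'.
  apply: (@qrel_fun _ _ (qcomp (qcomp f g) h) m) h'.
  by exists p; split=> //; exists n.
Defined.

Definition qproj : functor (Mod S) QMod.
Proof.
refine (@Functor (Mod S) QMod (fun M => M) qlin _ _ _).
- move=> M N f g fg; apply/qeqP => m n n' -> ->; rewrite fg subrr.
  by have [] := torsion_submod N.
- by move=> M; apply: qeq_refl.
- move=> M N P f g; apply/qeqP => m n n' -> [_ [-> ->]] /=; rewrite subrr.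
  by have [] := torsion_submod P.
Defined.

End Torsion.

(* The tensor product: finite formal sums of pairs, two of them being identified
   when no balanced biadditive map to an abelian group separates them. *)

Section Tensor.
Variables (S : pzRingType) (M : rmodType S) (N : lmodType S).
Implicit Types s t : seq (M * N).

Definition balanced (Z : zmodType) (b : M -> N -> Z) : Prop :=
  [/\ forall m m' n, b (m + m') n = b m n + b m' n,
      forall m n n', b m (n + n') = b m n + b m n'
    & forall m x n, b (ract m x) n = b m (x *: n)].

Definition fsum (Z : zmodType) (b : M -> N -> Z) s : Z :=
  \sum_(p <- s) b p.1 p.2.

Definition tens_rel s t : bool :=
  `[< forall (Z : zmodType) (b : M -> N -> Z), balanced b -> fsum b s = fsum b t >].

Lemma tens_rel_refl : reflexive tens_rel.
Proof. by move=> s; apply/asboolP. Qed.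
Lemma tens_rel_sym : symmetric tens_rel.
Proof. by move=> s t; apply/asboolP/asboolP => h Z b hb; rewrite h. Qed.
Lemma tens_rel_trans : transitive tens_rel.
Proof. by move=> s t u /asboolP h /asboolP h'; apply/asboolP => Z b hb; rewrite h ?h'. Qed.

Canonical tens_equiv :=
  EquivRel tens_rel tens_rel_refl tens_rel_sym tens_rel_trans.

Definition tens := {eq_quot tens_equiv}%qT.
HB.instance Definition _ := Choice.on tens.

Local Notation "[ 'cl' s ]" := (\pi_tens%qT s).
Definition tpure (m : M) (n : N) : tens := [cl [:: (m, n)]].

(* The map induced by b on the tensor product when b is balanced. *)
Definition tlift (Z : zmodType) (b : M -> N -> Z) (x : tens) : Z :=
  fsum b (repr x).

Lemma tlift_pi (Z : zmodType) (b : M -> N -> Z) s :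
  balanced b -> tlift b [cl s] = fsum b s.
Proof.
move=> hb; rewrite /tlift.
have /eqmodP/asboolP : (repr [cl s] = s %[mod_eq tens_equiv])%qT by rewrite reprK.
exact.
Qed.

Lemma tensP (x y : tens) :
  (forall (Z : zmodType) (b : M -> N -> Z), balanced b -> tlift b x = tlift b y) ->
  x = y.
Proof.
move=> h; rewrite -[x]reprK -[y]reprK; apply/eqmodP/asboolP => Z b hb.
exact: h.
Qed.

Definition tadd (x y : tens) : tens := [cl repr x ++ repr y].
Definition tzero : tens := [cl [::]].
Definition topp (x : tens) : tens := [cl [seq (- p.1, p.2) | p <- repr x]].

Lemma balancedN (Z : zmodType) (b : M -> N -> Z) m n :
  balanced b -> b (- m) n = - b m n.
Proof.
case=> bD _ _; apply/eqP; rewrite -addr_eq0 -bD addNr.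
by rewrite -(addrK (b 0 n) (b 0 n)) -bD addr0 subrr.
Qed.

Lemma tlift_add (Z : zmodType) (b : M -> N -> Z) x y :
  balanced b -> tlift b (tadd x y) = tlift b x + tlift b y.
Proof. by move=> hb; rewrite tlift_pi // /fsum big_cat. Qed.
Lemma tlift_zero (Z : zmodType) (b : M -> N -> Z) :
  balanced b -> tlift b tzero = 0.
Proof. by move=> hb; rewrite tlift_pi // /fsum big_nil. Qed.
Lemma tlift_opp (Z : zmodType) (b : M -> N -> Z) x :
  balanced b -> tlift b (topp x) = - tlift b x.
Proof.
move=> hb; rewrite tlift_pi // /fsum big_map -sumrN.
by apply: eq_bigr => p _; rewrite balancedN.
Qed.

Lemma taddA : associative tadd.
Proof. by move=> x y z; apply: tensP => Z b hb; rewrite !tlift_add // addrA. Qed.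
Lemma taddC : commutative tadd.
Proof. by move=> x y; apply: tensP => Z b hb; rewrite !tlift_add // addrC. Qed.
Lemma tadd0 : left_id tzero tadd.
Proof. by move=> x; apply: tensP => Z b hb; rewrite tlift_add // tlift_zero // add0r. Qed.
Lemma taddN : left_inverse tzero topp tadd.
Proof.
move=> x; apply: tensP => Z b hb.
by rewrite tlift_add // tlift_zero // tlift_opp // addNr.
Qed.

HB.instance Definition _ := GRing.isZmodule.Build tens taddA taddC tadd0 taddN.

Lemma tliftD (Z : zmodType) (b : M -> N -> Z) x y :
  balanced b -> tlift b (x + y) = tlift b x + tlift b y.
Proof. exact: tlift_add. Qed.
Lemma tlift0 (Z : zmodType) (b : M -> N -> Z) : balanced b -> tlift b 0 = 0.
Proof. exact: tlift_zero. Qed.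
Lemma tlift_pure (Z : zmodType) (b : M -> N -> Z) m n :
  balanced b -> tlift b (tpure m n) = b m n.
Proof. by move=> hb; rewrite tlift_pi // /fsum big_seq1. Qed.

Lemma tpure_balanced : balanced tpure.
Proof.
split=> [m m' n|m n n'|m x n]; apply: tensP => Z b hb;
by rewrite ?tliftD ?tlift_pure //; case: hb => bl br bm; rewrite ?bl ?br ?bm.
Qed.

Lemma tlift_sum (Z : zmodType) (b : M -> N -> Z) (I : Type) (s : seq I) (F : I -> tens) :
  balanced b -> tlift b (\sum_(i <- s) F i) = \sum_(i <- s) tlift b (F i).
Proof.
move=> hb; elim: s => [|i s IHs]; first by rewrite !big_nil tlift0.
by rewrite !big_cons tliftD // IHs.
Qed.

Lemma tensE x : x = \sum_(p <- repr x) tpure p.1 p.2.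
Proof.
apply: tensP => Z b hb; rewrite tlift_sum // /tlift {1}/fsum.
by apply: eq_bigr => p _; rewrite -/(tlift b (tpure p.1 p.2)) tlift_pure.
Qed.

Lemma tens_ind (P : tens -> Prop) : P 0 ->
  (forall x y, P x -> P y -> P (x + y)) -> (forall m n, P (tpure m n)) ->
  forall x, P x.
Proof. by move=> P0 PD Pp x; rewrite [x]tensE; apply: big_ind. Qed.

End Tensor.

Record bimodule (S T : pzRingType) := Bimodule {
  bimod_left :> lmodType S;
  bract : bimod_left -> T -> bimod_left;
  bractDl : forall n n' x, bract (n + n') x = bract n x + bract n' x;
  bractDr : forall n x x', bract n (x + x') = bract n x + bract n x';
  bract1 : forall n, bract n 1 = n;
  bractA : forall n x y, bract (bract n x) y = bract n (x * y);
  bractZ : forall s n x, bract (s *: n) x = s *: bract n x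
}.

Section BimoduleTensor.
Variables (S T : pzRingType) (M : rmodType S) (N : bimodule S T).

Definition btens : Type := tens M N.
HB.instance Definition _ := GRing.Zmodule.on btens.

Lemma btens_balanced (x : T) :
  balanced (fun (m : M) (n : N) => tpure m (bract n x) : btens).
Proof.
have [bl br bm] := tpure_balanced M N.
by split=> *; rewrite ?bractDl ?bractZ ?bl ?br ?bm.
Qed.

Definition btens_scale (x : T^c) (u : btens) : btens :=
  tlift (fun (m : M) (n : N) => tpure m (bract n x) : btens) u.

Let sD x u v : btens_scale x (u + v) = btens_scale x u + btens_scale x v.
Proof. exact/tliftD/btens_balanced. Qed.
Let s0 x : btens_scale x 0 = 0.
Proof. exact/tlift0/btens_balanced. Qed.
Let sP x m n : btens_scale x (tpure m n) = tpure m (bract n x).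
Proof. exact: tlift_pure (btens_balanced _). Qed.

Let bA x y u : btens_scale x (btens_scale y u) = btens_scale (x * y) u.
Proof.
move: u; apply: tens_ind => [|u v hu hv|m n]; first by rewrite !s0.
  by rewrite !sD hu hv.
by rewrite !sP bractA.
Qed.
Let b1 : left_id 1 btens_scale.
Proof.
apply: tens_ind => [|u v hu hv|m n]; first by rewrite s0.
  by rewrite sD hu hv.
by rewrite sP bract1.
Qed.
Let bDl u : {morph btens_scale^~ u : x y / x + y}.
Proof.
move=> x y; move: u; apply: tens_ind => [|u v hu hv|m n]; first by rewrite !s0 addr0.
  by rewrite !sD hu hv addrACA.
by rewrite !sP bractDr; case: (tpure_balanced M N) => _ -> _.
Qed.
HB.instance Definition _ :=
  GRing.Zmodule_isLmodule.Build T^c btens bA b1 sD bDl.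

Lemma btens_pureZ (m : M) (n : N) (x : T) :
  ract (tpure m n : btens) x = tpure m (bract n x).
Proof. exact: sP. Qed.

End BimoduleTensor.

Section TensorFunctor.
Variables (S T : pzRingType) (N : bimodule S T).

Section TensorMap.
Variables (M M' : rmodType S) (f : {linear M -> M'}).

Definition tmap_fun (u : btens M N) : btens M' N :=
  tlift (fun m (n : N) => tpure (f m) n : btens M' N) u.

Lemma tmap_balanced : balanced (fun m (n : N) => tpure (f m) n : btens M' N).
Proof.
have [bl br bm] := tpure_balanced M' N.
by split=> [m m' n|m n n'|m x n]; rewrite ?raddfD ?bl ?br // -bm /ract linearZ.
Qed.

Lemma tmap_pure m n : tmap_fun (tpure m n) = tpure (f m) n.
Proof. exact: tlift_pure tmap_balanced. Qed.

Lemma tmap_linear : linear tmap_fun.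
Proof.
move=> x u v; rewrite /tmap_fun tliftD; last exact: tmap_balanced.
congr (_ + _); move: u; apply: tens_ind.
- by rewrite scaler0 tlift0 ?scaler0 //; apply: tmap_balanced.
- move=> u w hu hw; rewrite scalerDr !tliftD ?hu ?hw ?scalerDr //;
  exact: tmap_balanced.
- move=> m n; rewrite -!/(tmap_fun _) [x *: _]btens_pureZ !tmap_pure.
  by rewrite [RHS]btens_pureZ.
Qed.

HB.instance Definition _ :=
  GRing.isLinear.Build T^c (btens M N) (btens M' N) _ tmap_fun tmap_linear.

Definition tmap : {linear btens M N -> btens M' N} := tmap_fun.

End TensorMap.

Definition tensor_functor : functor (Mod S) (Mod T).
Proof.
refine (@Functor (Mod S) (Mod T) (fun M => btens M N : rmodType T) tmap _ _ _).
- by move=> M M' f g fg u; apply: eq_bigr => p _; rewrite fg.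
- move=> M; apply: tens_ind => [|u v|m n]; first by rewrite raddf0.
    by rewrite raddfD /= => -> ->.
  exact: tmap_pure.
- move=> M M' M'' f g; apply: tens_ind => [|u v|m n].
  + by rewrite !raddf0.
  + by rewrite !raddfD /= => -> ->.
  + by rewrite /= !tmap_pure.
Defined.

End TensorFunctor.

Lemma right_noetherian_span (S : pzRingType) :
  (forall I : S -> Prop, right_ideal I -> exists s : seq S,
    {in s, forall u, I u} /\
    forall J, right_ideal J -> {in s, forall u, J u} -> forall x, I x -> J x) ->
  right_noetherian S.
Proof.
move=> h I /h[s [sI sJ]]; exists (undup s); split.
  by move=> u; rewrite mem_undup; apply: sI.
apply: sJ; first split.
- by exists (fun=> 0); rewrite big1 // => u _; rewrite mulr0.
- move=> x y [c ->] [d ->]; exists (fun u => c u + d u).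
  by rewrite -big_split; apply: eq_bigr => u _; rewrite mulrDr.
- move=> x y [c ->]; exists (fun u => c u * y); rewrite mulr_suml.
  by apply: eq_bigr => u _; rewrite mulrA.
move=> u us; exists (fun v => if v == u then 1 else 0).
rewrite (bigD1_seq u) ?mem_undup ?undup_uniq //= eqxx mulr1 big1 ?addr0 // => v.
by move=> /negPf->; rewrite mulr0.
Qed.

Lemma noetherian_ffun (R : comPzRingType) (I : finType) :
  right_noetherian R ->
  let sub (X : {ffun I -> R} -> Prop) :=
    [/\ X 0, forall f g, X f -> X g -> X (f + g)
      & forall f r, X f -> X [ffun i => f i * r]] in
  forall X, sub X -> exists s : seq {ffun I -> R},
    {in s, forall f, X f} /\
    forall Y, sub Y -> {in s, forall f, Y f} -> forall f, X f -> Y f.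
Proof.
move=> noeR sub.
suff h (e : seq I) : forall X, sub X ->
    (forall f, X f -> forall i, i \notin e -> f i = 0) ->
    exists s : seq {ffun I -> R}, {in s, forall f, X f} /\
      forall Y, sub Y -> {in s, forall f, Y f} -> forall f, X f -> Y f.
  by move=> X hX; apply: (h (enum I)) => // f _ i; rewrite mem_enum.
elim: e => [|i e IHe] X [X0 XD XZ] Xe.
  exists [::]; split=> // Y [Y0 _ _] _ f Xf; suff -> : f = 0 by [].
  by apply/ffunP => i; rewrite ffunE Xe.
pose P r := exists2 f, X f & f i = r.
have [|u [uP uS]] := noeR P.
  split; first by exists 0; rewrite ?ffunE.
    by move=> _ _ [f Xf <-] [g Xg <-]; exists (f + g); rewrite ?ffunE //; apply: XD.
  by move=> _ r [f Xf <-]; exists [ffun j => f j * r]; rewrite ?ffunE //; apply: XZ.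
have [t [tX tS]] : exists t : seq {ffun I -> R}, {in t, forall f, X f} /\
    {in u, forall r, exists2 f, f \in t & f i = r}.
  elim: u uP {uS} => [|r u IHu] uP; first by exists [::].
  have [t [tX tS]] := IHu (fun b bu => uP b (mem_behead (s := r :: u) bu)).
  have [f Xf fi] := uP r (mem_head r u).
  exists (f :: t); split=> [g|q]; rewrite inE => /predU1P[->//|].
  - exact: tX.
  - by exists f; rewrite ?mem_head.
  - by move=> /tS[g gt gi]; exists g; rewrite // inE gt orbT.
have XN f : X f -> X (- f).
  move=> /(XZ _ (-1)); suff -> : [ffun j => f j * -1] = - f by [].
  by apply/ffunP => j; rewrite !ffunE mulrN1.
have [||s [sX sS]] := IHe (fun f => X f /\ f i = 0).
- split=> [|f g [? fi] [? gi]|f r [? fi]]; rewrite !ffunE ?fi ?gi ?addr0 ?mul0r.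
  + by [].
  + by split; first exact: XD.
  + by split; first exact: XZ.
- move=> f [Xf fi] j je; have [->//|ji] := eqVneq j i.
  by apply: Xe; rewrite // inE negb_or ji.
exists (s ++ t); split=> [f|Y [Y0 YD YZ] hY f Xf].
  by rewrite mem_cat => /orP[/sX[]|/tX].
have [c fc] := uS (f i) (ex_intro2 _ _ f Xf erefl).
have [g [Xg Yg gi]] : exists g, [/\ X g, Y g & g i = f i].
  rewrite fc big_seq; apply: (big_ind (fun r => exists g, [/\ X g, Y g & g i = r])).
  - by exists 0; rewrite ffunE.
  - move=> _ _ [g [? ? <-]] [g' [? ? <-]]; exists (g + g').
    by rewrite ffunE; split=> //; [apply: XD|apply: YD].
  - move=> r /tS[g gt <-]; exists [ffun j => g j * c (g i)]; rewrite ffunE.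
    split=> //; [apply: XZ; exact: tX|apply: YZ; apply: hY].
    by rewrite mem_cat gt orbT.
rewrite -(subrK g f); apply: (YD) => //; apply: (sS Y (And3 Y0 YD YZ)).
  by move=> h hs; apply: hY; rewrite mem_cat hs.
by split; [apply: XD => //; apply: XN|rewrite !ffunE gi subrr].
Qed.

(* A commutative k-algebra is given by its structure morphism k -> R, so that
   the zero algebra is not excluded. *)

Record algebra_action (k : fieldType) (R : comPzRingType) (eta : {rmorphism k -> R})
    (gT : finGroupType) := AlgebraAction {
  gact :> gT -> {rmorphism R -> R};
  gact1 : forall r, gact 1%g r = r;
  gactM : forall g h r, gact (g * h)%g r = gact g (gact h r);
  gact_alg : forall g c, gact g (eta c) = eta c
}.

Section SkewGroupAlgebra.
Variables (k : fieldType) (R : comPzRingType) (eta : {rmorphism k -> R}).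
Variables (gT : finGroupType) (rho : algebra_action eta gT).

Lemma gactK g r : rho g (rho g^-1%g r) = r.
Proof. by rewrite -gactM mulgV gact1. Qed.
Lemma gactVK g r : rho g^-1%g (rho g r) = r.
Proof. by rewrite -gactM mulVg gact1. Qed.

Definition inv_pred : {pred R} := fun r => [forall g, rho g r == r].

Lemma inv_predP r : reflect (forall g, rho g r = r) (r \in inv_pred).
Proof. exact: 'forall_eqP. Qed.

Lemma inv_pred_subring : subring_closed inv_pred.
Proof.
split=> [|r s /inv_predP hr /inv_predP hs|r s /inv_predP hr /inv_predP hs];
  apply/inv_predP => g; by rewrite ?rmorph1 ?rmorphB ?rmorphM ?hr ?hs.
Qed.
HB.instance Definition _ := GRing.isSubringClosed.Build R inv_pred inv_pred_subring.

Record invariants := Invariants { inv_val :> R; inv_valP : inv_val \in inv_pred }.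
HB.instance Definition _ := [isSub of invariants for inv_val].
HB.instance Definition _ := [Choice of invariants by <:].
HB.instance Definition _ := GRing.SubChoice_isSubComPzRing.Build R inv_pred
  invariants (subringClosedP _).
HB.instance Definition _ := GRing.RMorphism.copy inv_val (\val : invariants -> R).

Lemma gact_inv g (a : invariants) : rho g (inv_val a) = inv_val a.
Proof. exact/inv_predP/inv_valP. Qed.

(* The skew group algebra R * G: the element \sum_g r_g (x) g of R (x) kG is
   the function g |-> r_g. *)

Definition skew : Type := {ffun gT -> R}.
HB.instance Definition _ := GRing.Zmodule.on skew.
Definition skew_coef (f : skew) : {ffun gT -> R} := f.
Coercion skew_coef : skew >-> finfun_of.
Definition skew_of (f : gT -> R) : skew := finfun f.

Lemma skewE f g : skew_of f g = f g. Proof. exact: ffunE. Qed.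
Lemma skewP (f f' : skew) : f =1 f' -> f = f'. Proof. by move=> ?; apply/ffunP. Qed.
Lemma skewD (f f' : skew) g : (f + f') g = f g + f' g. Proof. exact: ffunE. Qed.
Lemma skew0 g : (0 : skew) g = 0. Proof. exact: ffunE. Qed.

Definition skew_pure (r : R) (g : gT) : skew :=
  skew_of (fun h => if h == g then r else 0).

Definition skew_one : skew := skew_pure 1 1%g.
Definition skew_mul (f f' : skew) : skew :=
  skew_of (fun x => \sum_g f g * rho g (f' (g^-1 * x)%g)).

Lemma skew_mulE f f' x : skew_mul f f' x = \sum_g f g * rho g (f' (g^-1 * x)%g).
Proof. exact: skewE. Qed.

Lemma skew_pure_mul r f g x : skew_mul (skew_pure r g) f x = r * rho g (f (g^-1 * x)%g).
Proof.
rewrite skew_mulE (bigD1 g) //= skewE eqxx big1 ?addr0 // => h /negPf hg.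
by rewrite skewE hg mul0r.
Qed.

Lemma skew_pureM r g s h :
  skew_mul (skew_pure r g) (skew_pure s h) = skew_pure (r * rho g s) (g * h)%g.
Proof.
apply: skewP => x; rewrite skew_pure_mul !skewE.
rewrite (can2_eq (mulKVg g) (mulKg g)).
by case: eqP => _; rewrite // rmorph0 mulr0.
Qed.

Lemma skew_mulA : associative skew_mul.
Proof.
move=> f1 f2 f3; apply: skewP => x; rewrite !skew_mulE.
under [RHS]eq_bigr => h _ do rewrite skew_mulE mulr_suml.
rewrite [RHS]exchange_big; apply: eq_bigr => g _.
rewrite skew_mulE rmorph_sum mulr_sumr (reindex_inj (mulgI g^-1)%g) /=.
apply: eq_bigr => h _; rewrite rmorphM -gactM invMg invgK -!mulgA !mulKVg.
by rewrite mulrA.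
Qed.

Lemma skew_mul1 : left_id skew_one skew_mul.
Proof.
by move=> f; apply: skewP => x; rewrite skew_pure_mul gact1 invg1 mul1g mul1r.
Qed.

Lemma skew_mulr1 : right_id skew_one skew_mul.
Proof.
move=> f; apply: skewP => x; rewrite skew_mulE (bigD1 x) //= mulVg skewE eqxx.
rewrite rmorph1 mulr1 big1 ?addr0 // => g gx; rewrite skewE -eq_mulVg1 (negPf gx).
by rewrite rmorph0 mulr0.
Qed.

Lemma skew_mulDl : left_distributive skew_mul +%R.
Proof.
move=> f g h; apply: skewP => x; rewrite skewD !skew_mulE -big_split.
by apply: eq_bigr => i _; rewrite skewD mulrDl.
Qed.

Lemma skew_mulDr : right_distributive skew_mul +%R.
Proof.
move=> f g h; apply: skewP => x; rewrite skewD !skew_mulE -big_split.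
by apply: eq_bigr => i _; rewrite skewD rmorphD mulrDr.
Qed.

HB.instance Definition _ := GRing.Zmodule_isPzRing.Build skew
  skew_mulA skew_mul1 skew_mulr1 skew_mulDl skew_mulDr.

Lemma skewM (f f' : skew) x : (f * f') x = \sum_g f g * rho g (f' (g^-1 * x)%g).
Proof. exact: skew_mulE. Qed.

Definition skew_emb (r : R) : skew := skew_pure r 1%g.
Lemma skew_emb_additive : zmod_morphism skew_emb.
Proof.
by move=> r s; apply: skewP => g; rewrite !ffunE; case: eqP; rewrite ?subr0.
Qed.
HB.instance Definition _ := GRing.isZmodMorphism.Build R skew skew_emb skew_emb_additive.
Lemma skew_emb_mult : monoid_morphism skew_emb.
Proof.
by split=> // r s; rewrite [RHS]skew_pureM gact1 mulg1.
Qed.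
HB.instance Definition _ := GRing.isMonoidMorphism.Build R skew skew_emb skew_emb_mult.

Definition skew_mod : Type := R.
HB.instance Definition _ := GRing.Zmodule.on skew_mod.

Definition skew_scale (f : skew) (x : skew_mod) : skew_mod :=
  \sum_g f g * rho g x.

Lemma skew_scaleA f f' x : skew_scale f (skew_scale f' x) = skew_scale (f * f') x.
Proof.
rewrite /skew_scale.
under [RHS]eq_bigr => h _ do rewrite skewM mulr_suml.
rewrite exchange_big; apply: eq_bigr => g _.
rewrite [in RHS](reindex_inj (mulgI g)) rmorph_sum mulr_sumr; apply: eq_bigr => h _.
by rewrite rmorphM -gactM mulKg mulrA.
Qed.

Lemma skew_scale_pure r g x : skew_scale (skew_pure r g) x = r * rho g x.
Proof.
rewrite /skew_scale (bigD1 g) //= skewE eqxx big1 ?addr0 // => h /negPf hg.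
by rewrite skewE hg mul0r.
Qed.

Lemma skew_scale1 : left_id 1 skew_scale.
Proof. by move=> x; rewrite [LHS]skew_scale_pure gact1 mul1r. Qed.

Lemma skew_scaleDr : right_distributive skew_scale +%R.
Proof.
move=> f x y; rewrite /skew_scale -big_split.
by apply: eq_bigr => g _; rewrite rmorphD mulrDr.
Qed.

Lemma skew_scaleDl x : {morph skew_scale^~ x : f f' / f + f'}.
Proof.
move=> f f'; rewrite /skew_scale -big_split.
by apply: eq_bigr => g _; rewrite skewD mulrDl.
Qed.

HB.instance Definition _ := GRing.Zmodule_isLmodule.Build skew skew_mod
  skew_scaleA skew_scale1 skew_scaleDr skew_scaleDl.

Definition skew_bimod : bimodule skew invariants.
Proof.
refine (@Bimodule skew invariants skew_mod (fun x a => (x : R) * inv_val a) _ _ _ _ _).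
- by move=> n n' x; rewrite mulrDl.
- by move=> n x x'; rewrite mulrDr.
- by move=> n; rewrite mulr1.
- by move=> n x y; rewrite mulrA.
- move=> f n a; rewrite [LHS]mulr_suml; apply: eq_bigr => g _.
  by rewrite rmorphM gact_inv mulrA.
Defined.

Definition pertinent (n : nat) (a b : 'I_n -> R) : Prop :=
  forall g : gT, g != 1%g -> \sum_(i < n) a i * rho g (b i) = 0.

Definition radical (x : R) : Prop :=
  exists (n : nat) (a b : 'I_n -> R),
    [/\ (1 <= n)%N, pertinent a b & x = \sum_(i < n) a i * b i].

Lemma radical_ideal : ideal radical.
Proof.
have radM x y : radical x -> radical (y * x).
  move=> [n [a [b [n1 pab ->]]]]; exists n, (fun i => y * a i), b; split=> //.
    move=> g /pab h; rewrite -[RHS](mulr0 y) -[in RHS]h mulr_sumr.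
    by apply: eq_bigr => i _; rewrite mulrA.
  by rewrite mulr_sumr; apply: eq_bigr => i _; rewrite mulrA.
split=> [|x y [n [a [b [n1 pab ->]]]] [m [c [d [m1 pcd ->]]]]|x y|x y /radM//].
- exists 1%N, (fun=> 0), (fun=> 0); split=> // [g _|]; by rewrite big_ord1 mul0r.
- exists (n + m)%N, (fun i => match split i with inl j => a j | inr j => c j end),
    (fun i => match split i with inl j => b j | inr j => d j end); split.
  + by rewrite addn_gt0 n1.
  + move=> g g1; rewrite big_split_ord /= -[RHS]addr0.
    congr (_ + _); [rewrite -[RHS](pab g g1)|rewrite -[RHS](pcd g g1)];
      apply: eq_bigr => i _.
      by rewrite (unsplitK (inl _ i)).
    by rewrite (unsplitK (inr _ i)).
  + rewrite big_split_ord /=; congr (_ + _); apply: eq_bigr => i _.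
      by rewrite (unsplitK (inl _ i)).
    by rewrite (unsplitK (inr _ i)).
- by rewrite mulrC; apply: radM.
Qed.

Lemma radical_stable g x : radical x -> radical (rho g x).
Proof.
move=> [n [a [b [n1 pab ->]]]].
exists n, (fun i => rho g (a i)), (fun i => rho g (b i)); split=> //.
  move=> h h1; have := pab (h ^ g)%g; rewrite conjg_eq1 => /(_ h1)/(congr1 (rho g)).
  rewrite rmorph0 rmorph_sum => e; rewrite -[RHS]e; apply: eq_bigr => i _.
  by rewrite rmorphM -!gactM conjgC conjgE !mulgA mulgV mul1g.
by rewrite rmorph_sum; apply: eq_bigr => i _; rewrite rmorphM.
Qed.

Definition inv_radical (a : invariants) : Prop := radical (inv_val a).
Definition skew_radical (f : skew) : Prop := forall g, radical (f g).

Lemma inv_radical_ideal : ideal inv_radical.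
Proof.
have [r0 rD rr rl] := radical_ideal; split.
- by rewrite /inv_radical raddf0.
- by move=> x y; rewrite /inv_radical raddfD; apply: rD.
- by move=> x y; rewrite /inv_radical rmorphM; apply: rr.
- by move=> x y; rewrite /inv_radical rmorphM; apply: rl.
Qed.

Lemma skew_radical_ideal : ideal skew_radical.
Proof.
have [r0 rD rr rl] := radical_ideal; split.
- by move=> g; rewrite skew0.
- by move=> f f' hf hf' g; rewrite skewD; apply: rD.
- move=> f f' hf x; rewrite skewM; apply: big_ind => // g _; exact: rr.
- move=> f f' hf x; rewrite skewM; apply: big_ind => // g _.
  exact/rl/radical_stable.
Qed.

Lemma skew_noetherian : right_noetherian R -> right_noetherian skew.
Proof.
move=> noeR; apply: right_noetherian_span => I [I0 ID Ir].
pose untw (f : {ffun gT -> R}) : skew := skew_of (fun g => rho g (f g)).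
pose tw (f : skew) : {ffun gT -> R} := [ffun g => rho g^-1%g (f g)].
have twK f : untw (tw f) = f by apply: skewP => g; rewrite skewE ffunE gactK.
have untw0 : untw 0 = 0 by apply: skewP => g; rewrite skewE !ffunE rmorph0.
have untwD f f' : untw (f + f') = untw f + untw f'.
  by apply: skewP => g; rewrite skewE !ffunE rmorphD.
have untwM (f : {ffun gT -> R}) r : untw [ffun g => f g * r] = untw f * skew_emb r.
  apply: skewP => g; rewrite skewM skewE ffunE rmorphM (bigD1 g) //= mulVg !skewE.
  rewrite eqxx big1 ?addr0 // => h hg; rewrite !skewE -eq_mulVg1 (negPf hg).
  by rewrite rmorph0 mulr0.
have sub J : right_ideal J -> [/\ J (untw 0),
    forall f g, J (untw f) -> J (untw g) -> J (untw (f + g))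
    & forall (f : {ffun gT -> R}) r,
        J (untw f) -> J (untw [ffun g => f g * r])].
  move=> [J0 JD Jr]; split=> [|f g|f r]; rewrite ?untw0 ?untwD ?untwM //.
    exact: JD.
  exact: Jr.
have [|s [sI sS]] := noetherian_ffun noeR (X := fun f => I (untw f)).
  exact: sub.
exists (map untw s); split=> [_ /mapP[f /sI + ->]//|J hJ sJ x Ix].
rewrite -(twK x); apply: (sS (fun f => J (untw f))); first exact: sub.
  by move=> f fs; apply/sJ/map_f.
by rewrite twK.
Qed.

Section Reynolds.
Hypothesis charG : [pchar k]^'.-nat #|[set: gT]|.

Definition ninv : R := eta (#|[set: gT]|%:R^-1).

Lemma ninvE : \sum_(g : gT) ninv = 1.
Proof.
rewrite sumr_const -cardsT /ninv -[LHS]mulr_natr -(rmorph_nat eta) -rmorphM.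
rewrite mulVf ?rmorph1 //.
by rewrite natf_neq0_pchar.
Qed.

Definition reynolds_val (r : R) : R := \sum_g rho g r * ninv.

Lemma reynolds_subproof r : reynolds_val r \in inv_pred.
Proof.
apply/inv_predP => h; rewrite rmorph_sum [RHS](reindex_inj (mulgI h)).
by apply: eq_bigr => g _; rewrite rmorphM -gactM gact_alg.
Qed.

Definition reynolds (r : R) : invariants := Invariants (reynolds_subproof r).

Lemma reynoldsD r s : reynolds (r + s) = reynolds r + reynolds s.
Proof.
apply: val_inj; rewrite /= /reynolds_val -big_split.
by apply: eq_bigr => g _; rewrite rmorphD mulrDl.
Qed.
Lemma reynolds0 : reynolds 0 = 0.
Proof. by apply: val_inj; rewrite /= /reynolds_val big1 // => g _; rewrite rmorph0 mul0r. Qed.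
Lemma reynoldsM (a : invariants) r : reynolds (inv_val a * r) = a * reynolds r.
Proof.
apply: val_inj; rewrite /= /reynolds_val mulr_sumr; apply: eq_bigr => g _.
by rewrite rmorphM gact_inv mulrA.
Qed.
Lemma reynolds_id (a : invariants) : reynolds (inv_val a) = a.
Proof.
apply: val_inj; rewrite /= /reynolds_val -[RHS]mulr1 -ninvE mulr_sumr.
by apply: eq_bigr => g _; rewrite gact_inv.
Qed.

Lemma invariants_noetherian : right_noetherian R -> right_noetherian invariants.
Proof.
move=> noeR; apply: right_noetherian_span => I [I0 ID Ir].
pose ext (J : invariants -> Prop) :=
  idealM (fun r => exists2 a, J a & inv_val a = r) (fun=> True).
have ext_r J r s : ext J r -> ext J (r * s).
  move: r; apply: idealM_ind; first by rewrite mul0r; apply: idealM0.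
    by move=> *; rewrite mulrDl; apply: idealM_add.
  by move=> *; rewrite -mulrA; apply: idealM_mul.
have mono (v w : seq invariants) x : {subset v <= w} ->
    ext (fun a => a \in v) x -> ext (fun a => a \in w) x.
  move=> vw; move: x; apply: idealM_ind.
  - exact: idealM0.
  - exact: idealM_add.
  - by move=> _ z [a aT <-] _; apply: idealM_mul => //; exists a; rewrite ?vw.
have [|u [uI uS]] := noeR (ext I).
  split; [exact: idealM0 | exact: idealM_add | exact: ext_r].
have [s [sI sS]] : exists s : seq invariants, {in s, forall a, I a} /\
    {in u, forall r, ext (fun a => a \in s) r}.
  elim: u uI {uS} => [|r u IHu] uI; first by exists [::].
  have [s [sI sS]] := IHu (fun b bu => uI b (mem_behead (s := r :: u) bu)).
  have [t [tI tr]] : exists t : seq invariants, {in t, forall a, I a} /\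
      ext (fun a => a \in t) r.
    move: (uI r (mem_head r u)); move: r {uI}; apply: idealM_ind.
    - by exists [::]; split=> //; apply: idealM0.
    - move=> x y [t [tI tx]] [t' [tI' ty]]; exists (t ++ t'); split.
        by move=> a; rewrite mem_cat => /orP[/tI|/tI'].
      by apply: idealM_add; [apply: mono tx|apply: mono ty] => a aT;
        rewrite mem_cat aT ?orbT.
    - move=> _ z [a Ia <-] _; exists [:: a]; split=> [b|].
        by rewrite inE => /eqP->.
      by apply: idealM_mul => //; exists a; rewrite ?mem_head.
  exists (s ++ t); split=> [a|q]; first by rewrite mem_cat => /orP[/sI|/tI].
  by rewrite inE => /predU1P[->|/sS h]; [apply: mono tr|apply: mono h] => a aT;
    rewrite mem_cat aT ?orbT.
exists s; split=> // J [J0 JD Jr] sJ x Ix.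
have [|c xc] := uS (inv_val x).
  by rewrite -[inv_val x]mulr1; apply: idealM_mul => //; exists x.
rewrite -(reynolds_id x) xc big_seq.
suff : forall r, ext (fun a => a \in s) r -> J (reynolds r).
  apply; apply: big_ind => [||r ru]; [exact: idealM0|exact: idealM_add|].
  exact/ext_r/sS.
apply: idealM_ind; first by rewrite reynolds0.
  by move=> r r' ? ?; rewrite reynoldsD; apply: JD.
by move=> _ r [a aS <-] _; rewrite reynoldsM; apply/Jr/sJ.
Qed.

Hypothesis noeR : right_noetherian R.

Definition QModB : category := QMod skew_radical_ideal (skew_noetherian noeR).
Definition QModA : category := QMod inv_radical_ideal (invariants_noetherian noeR).

Section QTensor.

Local Notation tensR M := (btens M skew_bimod).

(* M (x)_B R is a summand of M: m (x) r is sent to m (r (x) 1) e, where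
   e = |G|^-1 \sum_g 1 (x) g. *)
Definition avg (r : R) : skew := skew_of (fun=> r * ninv).

Lemma avgD r s : avg (r + s) = avg r + avg s.
Proof. by apply: skewP => g; rewrite skewD !skewE mulrDl. Qed.
Lemma avg_scale (f : skew) r : f * avg r = avg (skew_scale f r).
Proof.
apply: skewP => x; rewrite skewM skewE /skew_scale mulr_suml; apply: eq_bigr => g _.
by rewrite skewE rmorphM gact_alg mulrA.
Qed.
Lemma avg_scale1 r : skew_scale (avg r) (1 : R) = r.
Proof.
rewrite /skew_scale -[RHS]mulr1 -[in RHS]ninvE mulr_sumr; apply: eq_bigr => g _.
by rewrite skewE rmorph1 mulr1.
Qed.

Definition tproj (M : rmodType skew) : tensR M -> M :=
  tlift (fun m (r : skew_mod) => ract m (avg r)).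

Lemma tproj_balanced (M : rmodType skew) :
  balanced (fun (m : M) (r : skew_mod) => ract m (avg r)).
Proof.
split=> [m m' r|m r r'|m f r]; first by rewrite ractDl.
  by rewrite avgD ractDr.
by rewrite ractA avg_scale.
Qed.

Lemma tproj_pure (M : rmodType skew) m r :
  tproj (tpure m r : tensR M) = ract m (avg r).
Proof. exact: tlift_pure (tproj_balanced M). Qed.
Lemma tproj0 (M : rmodType skew) : tproj (0 : tensR M) = 0.
Proof. exact: tlift0 (tproj_balanced M). Qed.
Lemma tprojD (M : rmodType skew) (u v : tensR M) : tproj (u + v) = tproj u + tproj v.
Proof. exact: tliftD (tproj_balanced M). Qed.

Definition tincl (M : rmodType skew) (m : M) : tensR M := @tpure skew M skew_bimod m (1 : R).
Lemma tinclD (M : rmodType skew) (m n : M) : tincl (m + n) = tincl m + tincl n.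
Proof. by case: (tpure_balanced M skew_bimod) => + _ _; apply. Qed.
Lemma tincl0 (M : rmodType skew) : tincl (0 : M) = 0.
Proof. by apply: (addIr (tincl (0 : M))); rewrite -tinclD !add0r. Qed.
Lemma tinclN (M : rmodType skew) (m : M) : tincl (- m) = - tincl m.
Proof. by apply/eqP; rewrite -addr_eq0 -tinclD addNr tincl0. Qed.

Lemma tprojK (M : rmodType skew) (u : tensR M) : tincl (tproj u) = u.
Proof.
move: u; apply: tens_ind => [|u v|m r]; first by rewrite tproj0 tincl0.
  by rewrite tprojD tinclD => -> ->.
have [_ _ tb] := tpure_balanced M skew_bimod.
by rewrite tproj_pure /tincl tb; congr tpure; apply: avg_scale1.
Qed.

Lemma tpure_inv (M : rmodType skew) m r (a : invariants) :
  ract (tpure m r : tensR M) a = tpure (ract m (skew_emb (inv_val a))) r.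
Proof.
have [_ _ tb] := tpure_balanced M skew_bimod.
rewrite btens_pureZ tb; congr tpure.
by rewrite [RHS]skew_scale_pure gact1 mulrC.
Qed.

Lemma inv_radicalX n a :
  idealX inv_radical n a -> idealX skew_radical n (skew_emb (inv_val a)).
Proof.
apply: (idealX_morph (f := skew_emb \o inv_val)) => x hx g /=.
by have [r0 _ _ _] := radical_ideal; rewrite skewE; case: eqP.
Qed.

Lemma tincl_torsion (M : rmodType skew) (m : M) :
  torsion skew_radical m -> torsion inv_radical (tincl m).
Proof.
move=> [n hn]; exists n => a /inv_radicalX/hn.
by rewrite tpure_inv => ->; apply: tincl0.
Qed.

Section QTensorMap.
Variables (M N : rmodType skew) (f : qhom skew_radical M N).

(* A morphism f of the quotient category is the fraction M <- f -> N, with f a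
   submodule of M x N.  Its image under the induced functor is the fraction
   M (x)_B R <- f (x)_B R -> N (x)_B R, recorded by the image of f (x)_B R in
   (M (x)_B R) x (N (x)_B R). *)
Definition qtens_rel (u : tensR M) (v : tensR N) : Prop :=
  exists s : seq (M * N * skew_bimod),
    [/\ {in s, forall p, f p.1.1 p.1.2},
        u = \sum_(p <- s) tpure p.1.1 p.2
      & v = \sum_(p <- s) tpure p.1.2 p.2].

Lemma qtens_rel0 : qtens_rel 0 0.
Proof. by exists [::]; rewrite !big_nil. Qed.
Lemma qtens_relD u u' v v' :
  qtens_rel u v -> qtens_rel u' v' -> qtens_rel (u + u') (v + v').
Proof.
move=> [s [sP -> ->]] [t [tP -> ->]]; exists (s ++ t); rewrite !big_cat.
by split=> // p; rewrite mem_cat => /orP[/sP|/tP].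
Qed.
Lemma qtens_rel_pure m n r : f m n -> qtens_rel (tpure m r) (tpure n r).
Proof.
move=> fmn; exists [:: (m, n, r)]; rewrite !big_seq1; split=> // p.
by rewrite inE => /eqP->.
Qed.
Lemma qtens_rel_ind (P : tensR M -> tensR N -> Prop) : P 0 0 ->
  (forall u u' v v', P u v -> P u' v' -> P (u + u') (v + v')) ->
  (forall m n r, f m n -> P (tpure m r) (tpure n r)) ->
  forall u v, qtens_rel u v -> P u v.
Proof.
move=> P0 PD Pp u v [s [sP -> ->]]; elim: s sP => [|p s IHs] sP.
  by rewrite !big_nil.
rewrite !big_cons; apply: PD; first by apply/Pp/sP/mem_head.
by apply: IHs => q qs; apply: sP; rewrite inE qs orbT.
Qed.
Lemma qtens_relZ u v (a : invariants) :
  qtens_rel u v -> qtens_rel (ract u a) (ract v a).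
Proof.
move: u v; apply: qtens_rel_ind => [|u u' v v' h h'|m n r h].
- by rewrite !ract0l; apply: qtens_rel0.
- by rewrite !ractDl; apply: qtens_relD.
- by rewrite !tpure_inv; apply/qtens_rel_pure/qrelZ.
Qed.
Lemma qtens_rel_proj u v : qtens_rel u v -> f (tproj u) (tproj v).
Proof.
move: u v; apply: qtens_rel_ind => [|u u' v v' h h'|m n r h].
- by rewrite !tproj0; apply: qrel0.
- by rewrite !tprojD; apply: qrelD.
- by rewrite !tproj_pure; apply: qrelZ.
Qed.

Definition qtens_map : qhom inv_radical (tensR M) (tensR N).
Proof.
exists qtens_rel.
- exact: qtens_rel0.
- by move=> *; apply: qtens_relD.
- exact: qtens_relZ.
- apply: tens_ind => [|u v [i hi] [j hj]|m r].
  + by exists 0 => a _; exists 0; rewrite ract0l; apply: qtens_rel0.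
  + exists (maxn i j) => a ha.
    have [u' hu] := hi a (idealX_anti inv_radical_ideal (leq_maxl _ _) ha).
    have [v' hv] := hj a (idealX_anti inv_radical_ideal (leq_maxr _ _) ha).
    by exists (u' + v'); rewrite ractDl; apply: qtens_relD.
  + have [i hi] := qrel_dom f m; exists i => a /inv_radicalX/hi[n hn].
    by exists (tpure n r); rewrite tpure_inv; apply: qtens_rel_pure.
- move=> v /qtens_rel_proj; rewrite tproj0 => /qrel_ker/tincl_torsion.
  by rewrite tprojK.
Defined.

End QTensorMap.

Lemma qtens_torsion (M : rmodType skew) (u v : tensR M) :
  torsion skew_radical (tproj u - tproj v) -> torsion inv_radical (u - v).
Proof. by move=> /tincl_torsion; rewrite tinclD tinclN !tprojK. Qed.

Let noeB := skew_noetherian noeR.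
Let noeA := invariants_noetherian noeR.

Definition qtensor_functor : functor QModB QModA.
Proof.
refine (@Functor QModB QModA (fun M => tensR M : rmodType invariants) qtens_map _ _ _).
- move=> M N f g /(qeqP skew_radical_ideal noeB) fg.
  apply/(qeqP inv_radical_ideal noeA) => u v v' /qtens_rel_proj h /qtens_rel_proj h'.
  exact/qtens_torsion/(fg _ _ _ h h').
- move=> M; apply/(qeqP inv_radical_ideal noeA) => u v v' /qtens_rel_proj h ->.
  by apply: qtens_torsion; rewrite h subrr; exists 0 => x _; rewrite ract0l.
- move=> M N P f g; apply/(qeqP inv_radical_ideal noeA) => u w w' /qtens_rel_proj h.
  move=> [v [/qtens_rel_proj h1 /qtens_rel_proj h2]]; apply: qtens_torsion.
  by apply: (qrel_fun h); exists (tproj v).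
Defined.

Lemma qtensor_functorE :
  nat_iso (functor_comp (qproj skew_radical_ideal noeB) qtensor_functor)
          (functor_comp (tensor_functor skew_bimod) (qproj inv_radical_ideal noeA)).
Proof.
exists (fun M => idm (tensR M : QModA)), (fun M => idm (tensR M : QModA)).
split=> [M N f|M|M]; try exact: comp1m.
apply: heq_trans (heq_sym (comp1m _)); apply: heq_trans (compm1 _) _.
apply/(qeqP inv_radical_ideal noeA) => u v v' /= /qtens_rel_proj h ->.
apply: qtens_torsion; rewrite h.
suff -> : f (tproj u) = tproj (tmap skew_bimod f u).
  by rewrite subrr; exists 0 => x _; rewrite ract0l.
move: u {v v' h}; apply: tens_ind => [|u v hu hv|m r].
- by rewrite raddf0 tproj0 !raddf0 tproj0.
- by rewrite raddfD tprojD raddfD [RHS]tprojD -hu -hv.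
- by rewrite tproj_pure [tmap _ _ _]tmap_pure tproj_pure /ract linearZ.
Qed.

End QTensor.
End Reynolds.
End SkewGroupAlgebra.

Arguments radical {k R eta gT} rho x.
Arguments inv_radical {k R eta gT} rho a.
Arguments skew_radical {k R eta gT} rho f.

(* The products a R and R a, along f : A -> R. *)
Definition ext_r (A R : pzRingType) (f : A -> R) (a : A -> Prop) : R -> Prop :=
  idealM (fun r => exists2 x, a x & f x = r) (fun=> True).
Definition ext_l (A R : pzRingType) (f : A -> R) (a : A -> Prop) : R -> Prop :=
  idealM (fun=> True) (fun r => exists2 x, a x & f x = r).

Definition cofinal (A R : pzRingType) (f : A -> R) (a : A -> Prop) (r : R -> Prop) :=
  (forall x, ext_r f a x <-> ext_l f a x) /\
  forall s : nat, exists n : nat, forall x, idealX r n x -> ext_r f (idealX a s) x.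

(* Main.v *)
(* Let e = |G|^-1 \sum_g 1 (x) g, so that eBe is isomorphic to A and M (x)_B R
   to Me.  By definition of pertinence, b is contained in BeB, and A is central
   in B.

   If the functor is faithful, then M = B/a^s B, which is sent to a module
   killed by a^s, is b-torsion.  So b^n is contained in a^s B for some n, that
   is, r^n in a^s R.

   Conversely, cofinality implies that an element m of M such that (mB)e is
   a-torsion is b-torsion.  Thus the functor is faithful, and it is full since
   phi : Me -> Ne extends to the pairs (m, n) such that phi maps mfe to nfe for
   all f in B.  It is always essentially surjective, since (N (x)_A eB)e is
   isomorphic to N. *)

From HB Require Import structures.
From mathcomp Require Import all_boot all_order all_fingroup all_algebra.
From mathcomp Require Import generic_quotient ring_quotient boolp.
Require Import Defs.

Set Implicit Arguments.
Unset Strict Implicit.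
Unset Printing Implicit Defensive.

Import GRing.Theory.
Local Open Scope ring_scope.

(** * Cancellation of split morphisms *)

Section CompEq.
Variables (E : category) (X Y Z : E).

Lemma comp_eql (f : hom X Y) (g g' : hom Y Z) :
  heq g g' -> heq (comp f g) (comp f g').
Proof. by apply: comp_heq; apply: heq_refl. Qed.

Lemma comp_eqr (f f' : hom X Y) (g : hom Y Z) :
  heq f f' -> heq (comp f g) (comp f' g).
Proof. by move=> ff'; apply: comp_heq => //; apply: heq_refl. Qed.

End CompEq.

(** [b] is a retraction of [a], so composing with it recovers [f] and [g]. *)
Lemma comp_split_eq (E : category) (X Y Z : E) (f g : hom X Y)
    (a : hom Y Z) (b : hom Z Y) :
  heq (comp a b) (idm Y) -> heq (comp f a) (comp g a) -> heq f g.
Proof.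
move=> ab fg.
have red (h : hom X Y) : heq (comp (comp h a) b) h.
  apply: heq_trans (heq_sym (compA _ _ _)) _.
  exact: heq_trans (comp_eql _ ab) (compm1 _).
apply: heq_trans (heq_sym (red f)) _; apply: heq_trans _ (red g).
exact: comp_eqr.
Qed.

Lemma split_comp_eq (E : category) (X Y Z : E) (f g : hom Y Z)
    (a : hom X Y) (b : hom Y X) :
  heq (comp b a) (idm Y) -> heq (comp a f) (comp a g) -> heq f g.
Proof.
move=> ba fg.
have red (h : hom Y Z) : heq (comp b (comp a h)) h.
  apply: heq_trans (compA _ _ _) _.
  exact: heq_trans (comp_eqr _ ba) (comp1m _).
apply: heq_trans (heq_sym (red f)) _; apply: heq_trans _ (red g).
exact: comp_eql.
Qed.

(** * Equivalences and fully faithful functors *)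

Section Equivalences.
Variables (C D : category) (F : functor C D).

Definition faithful : Prop :=
  forall (X Y : C) (f g : hom X Y), heq (fmap F f) (fmap F g) -> heq f g.

Definition full : Prop :=
  forall (X Y : C) (h : hom (F X) (F Y)), exists f : hom X Y, heq (fmap F f) h.

Definition essentially_surjective : Prop :=
  forall Y : D, exists (X : C) (a : hom (F X) Y) (b : hom Y (F X)),
    heq (comp a b) (idm (F X)) /\ heq (comp b a) (idm Y).

(** By naturality, [f] is [G (F f)] conjugated by the isomorphism from [G F] to the identity. *)
Lemma equivalence_faithful : is_equivalence F -> faithful.
Proof.
move=> [G [[a [b [na _ ba]]] _]] X Y f g /(@fmap_heq _ _ G) GFfg.
apply: (split_comp_eq (ba X)).
apply: heq_trans (heq_sym (na _ _ f)) _; apply: heq_trans _ (na _ _ g).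
exact: comp_eqr.
Qed.

(** The inverse is chosen on objects by essential surjectivity and on morphisms by fullness.
    Faithfulness reduces its functor laws and the unit equations to equations in [D]. *)
Lemma fully_faithful_equivalence :
  faithful -> full -> essentially_surjective -> is_equivalence F.
Proof.
move=> faithF fullF surjF.
pose G0 Y := sval (cid (surjF Y)).
pose a Y : hom (F (G0 Y)) Y := sval (cid (svalP (cid (surjF Y)))).
pose b Y : hom Y (F (G0 Y)) := sval (cid (svalP (cid (svalP (cid (surjF Y)))))).
have [ab ba] : (forall Y, heq (comp (a Y) (b Y)) (idm (F (G0 Y)))) /\
    (forall Y, heq (comp (b Y) (a Y)) (idm Y)).
  by split=> Y; have [] := svalP (cid (svalP (cid (svalP (cid (surjF Y)))))).
clearbody a b.
pose lift X Y (h : hom (F X) (F Y)) : hom X Y := sval (cid (fullF X Y h)).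
have liftE X Y (h : hom (F X) (F Y)) : heq (fmap F (lift X Y h)) h.
  exact: svalP (cid (fullF X Y h)).
clearbody lift.
pose G1 Y Y' (f : hom Y Y') := lift _ _ (comp (a Y) (comp f (b Y'))).
have G1a Y Y' (f : hom Y Y') :
    heq (comp (fmap F (G1 Y Y' f)) (a Y')) (comp (a Y) f).
  apply: heq_trans (comp_eqr _ (liftE _ _ _)) _.
  apply: heq_trans (heq_sym (compA _ _ _)) _; apply: comp_eql.
  apply: heq_trans (heq_sym (compA _ _ _)) _; apply: heq_trans (compm1 _).
  exact: comp_eql.
have G1_heq Y Y' (f g : hom Y Y') : heq f g -> heq (G1 Y Y' f) (G1 Y Y' g).
  move=> fg; apply/faithF/(comp_split_eq (ab Y')).
  apply: heq_trans (G1a _ _ _) _; apply: heq_trans _ (heq_sym (G1a _ _ _)).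
  exact: comp_eql.
have G1_1 Y : heq (G1 Y Y (idm Y)) (idm (G0 Y)).
  apply/faithF/(comp_split_eq (ab Y)).
  apply: heq_trans (G1a _ _ _) _; apply: heq_trans (compm1 _) _; apply: heq_sym.
  by apply: heq_trans (comp1m _); apply/comp_eqr/fmap1.
have G1_M X Y Z (f : hom X Y) (g : hom Y Z) :
    heq (G1 X Z (comp f g)) (comp (G1 X Y f) (G1 Y Z g)).
  apply/faithF/(comp_split_eq (ab Z)).
  apply: heq_trans (G1a _ _ _) _; apply: heq_sym.
  apply: heq_trans (comp_eqr _ (fmapM _ _ _)) _.
  apply: heq_trans (heq_sym (compA _ _ _)) _.
  apply: heq_trans (comp_eql _ (G1a _ _ _)) _.
  apply: heq_trans (compA _ _ _) _; apply: heq_trans _ (heq_sym (compA _ _ _)).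
  exact/comp_eqr/G1a.
exists (Functor G1_heq G1_1 G1_M); split.
  exists (fun X => lift _ _ (a (F X))), (fun X => lift _ _ (b (F X))).
  split=> [X Y f|X|X] /=; apply: faithF; apply: heq_trans (fmapM _ _ _) _.
  - apply: heq_trans (comp_eql _ (liftE _ _ _)) _.
    apply: heq_trans (G1a _ _ _) _; apply: heq_trans _ (heq_sym (fmapM _ _ _)).
    exact/comp_eqr/heq_sym/liftE.
  - apply: heq_trans (comp_heq (liftE _ _ _) (liftE _ _ _)) _.
    by apply: heq_trans (ab _) (heq_sym (fmap1 _ _)).
  - apply: heq_trans (comp_heq (liftE _ _ _) (liftE _ _ _)) _.
    by apply: heq_trans (ba _) (heq_sym (fmap1 _ _)).
by exists a, b; split=> // X Y f; apply: G1a.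
Qed.

End Equivalences.

(** * Quotient modules *)

Lemma quotient_module (S : pzRingType) (M : rmodType S) (P : M -> Prop) :
  submodule P -> exists (Q : rmodType S) (p : {linear M -> Q}),
    (forall q, exists m, p m = q) /\ (forall m, p m = 0 <-> P m).
Proof.
move=> [P0 PD Pr].
pose I : {pred M} := fun m => `[< P m >].
have I_closed : zmod_closed I.
  split=> [|x y /asboolP Px /asboolP Py]; apply/asboolP => //.
  by rewrite -(ractN1 y); apply/PD/Pr.
pose Ic : zmodClosed M := HB.pack_for (zmodClosed M) (I : M -> bool)
  (GRing.isZmodClosed.Build M I I_closed).
pose Q := {ideal_quot Ic}.
pose p : M -> Q := \pi_Q%qT.
have pE x y : (p x == p y) = `[< P (x - y) >].
  by rewrite -(Quotient.idealrBE Ic).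
(* Scalars act on a representative; [scE], where stability of [P] enters, shows that the choice does
   not matter. *)
pose sc (a : S^c) (q : Q) : Q := p (a *: repr q).
have scE a m : sc a (p m) = p (a *: m).
  apply/eqP; rewrite pE -scalerBr; apply/asboolP/Pr.
  by apply/asboolP; rewrite -pE /p reprK.
have pD x y : p (x + y) = p x + p y by rewrite /p -pi_addr.
have ps q : exists m, p m = q by exists (repr q); rewrite /p reprK.
have scA a b q : sc a (sc b q) = sc (a * b) q.
  by have [m <-] := ps q; rewrite !scE scalerA.
have sc1 : left_id 1 sc by move=> q; have [m <-] := ps q; rewrite scE scale1r.
have scDr : right_distributive sc +%R.
  move=> a q q'; have [m <-] := ps q; have [m' <-] := ps q'.
  by rewrite -pD !scE scalerDr pD.
have scDl q : {morph sc^~ q : a b / a + b}.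
  by move=> a b /=; have [m <-] := ps q; rewrite !scE scalerDl pD.
pose QM : rmodType S := HB.pack_for (rmodType S) Q
  (GRing.Zmodule_isLmodule.Build S^c Q scA sc1 scDr scDl).
have p_lin : linear (p : M -> QM).
  by move=> a x y; rewrite pD -scE.
pose pl : {linear M -> QM} := HB.pack_for {linear M -> QM} (p : M -> QM) 
  (GRing.isLinear.Build S^c M QM _ (p : M -> QM) p_lin).
exists QM, pl; split=> [//|m].
have pm0 : (p m == 0) = `[< P m >] by rewrite -[0](raddf0 pl) [LHS]pE subr0.
split=> [pm|Pm]; first by apply/asboolP; rewrite -pm0; apply/eqP.
by apply/eqP; rewrite [_ == _]pm0; apply/asboolP.
Qed.

(* R as an A-B-bimodule, isomorphic to eB.  The phantom argument rho lets the
   canonical structures below be inferred. *)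
Definition inv_mod (k : fieldType) (R : comPzRingType)
  (eta : {rmorphism k -> R}) (gT : finGroupType) (rho : algebra_action eta gT) : Type := R.
HB.instance Definition _ k R eta gT rho :=
  GRing.Zmodule.on (@inv_mod k R eta gT rho).

Definition inv_scale (k : fieldType) (R : comPzRingType)
    (eta : {rmorphism k -> R}) (gT : finGroupType) (rho : algebra_action eta gT)
    (a : invariants rho) (r : inv_mod rho) : inv_mod rho :=
  inv_val a * (r : R).

(** * Powers of the ideals in the skew group algebra *)

Section Morita.
Variables (k : fieldType) (R : comPzRingType) (eta : {rmorphism k -> R}).
Variables (gT : finGroupType) (rho : algebra_action eta gT).
Hypothesis charG : [pchar k]^'.-nat #|[set: gT]|.

Local Notation A := (invariants rho).
(** The type [skew] does not mention the action, but its multiplication does, so [B] names the ring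
    structure for [rho]. *)
Local Notation B := (Defs_skew__canonical__GRing_PzRing rho).
Local Notation emb r := (skew_emb gT r : B).
Local Notation e := (avg eta gT 1 : B).
Local Notation inv_emb a := (emb (inv_val a)).
Local Notation tensR M := (btens M (skew_bimod rho)).

Lemma skew_mul_emb (f : B) r g : (f * emb r) g = f g * rho g r.
Proof.
rewrite (skewM rho) (bigD1 g) //= mulVg skewE eqxx big1 ?addr0 // => h hg.
by rewrite skewE -eq_mulVg1 (negPf hg) rmorph0 mulr0.
Qed.

Lemma skew_emb_mul (f : B) r g : (emb r * f) g = r * f g.
Proof. by rewrite [LHS](skew_pure_mul rho) gact1 invg1 mul1g. Qed.

Lemma inv_emb_central (a : A) (f : B) : inv_emb a * f = f * inv_emb a.
Proof.
by apply: skewP => g; rewrite skew_mul_emb skew_emb_mul gact_inv mulrC.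
Qed.

Lemma skew_sum (I : Type) (s : seq I) (F : I -> B) g :
  (\sum_(i <- s) F i) g = \sum_(i <- s) F i g.
Proof. by elim/big_rec2: _ => [|i y z _ <-]; [apply: skew0 | apply: skewD]. Qed.

Lemma skew_decomp (f : B) : f = \sum_g emb (f g) * skew_pure 1 g.
Proof.
apply: skewP => x; rewrite skew_sum (bigD1 x) //= skew_emb_mul skewE eqxx mulr1.
rewrite big1 ?addr0 // => g gx.
by rewrite skew_emb_mul skewE eq_sym (negPf gx) mulr0.
Qed.

(* Pertinence says exactly that [\sum_i a_i e b_i = |G|^-1 r (x) 1]. *)
Lemma skew_radical_trace (P : B -> Prop) :
  (forall f f' : B, P f -> P f' -> P (f + f')) ->
  (forall f f' : B, P f -> P (f * f')) ->
  (forall f : B, P (f * e)) ->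
  forall f, skew_radical rho f -> P f.
Proof.
move=> PD Pr Pe f hf.
have P0 : P 0 by rewrite -(mul0r e).
rewrite (skew_decomp f); apply: big_ind => // g _; apply/Pr.
have [n [a [b [_ pab ->]]]] := hf g.
suff -> : emb (\sum_i a i * b i) = \sum_i emb (a i *+ #|gT|) * e * emb (b i).
  by apply: big_ind => // i _; apply/Pr/Pe.
apply: skewP => x; rewrite skew_sum.
have ninv1 : ninv eta gT *+ #|gT| = 1 by rewrite -sumr_const ninvE.
(* This is the coefficient at [x] of both sides: by pertinence it vanishes unless [x] is 1. *)
transitivity (\sum_i a i * rho x (b i)).
  rewrite skewE; case: eqP => [->|/eqP/pab ->//].
  by apply: eq_bigr => i _; rewrite gact1.
apply: eq_bigr => i _; rewrite skew_mul_emb skew_emb_mul skewE mul1r.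
by rewrite mulrnAl -mulrnAr ninv1 mulr1.
Qed.

(** The coefficients of a product involve translates [rho g] of coefficients of the second factor,
    and the radical is G-stable. *)
Lemma skew_radicalX n (f : B) :
  idealX (skew_radical rho) n f -> forall g, idealX (radical rho) n (f g).
Proof.
elim: n f => //= n IHn; apply: idealM_ind.
- by move=> g; rewrite skew0; apply: idealM0.
- by move=> f f' hf hf' g; rewrite skewD; apply: idealM_add.
move=> f f' /IHn hf hf' x; rewrite (skewM rho).
apply: big_ind => [||g _]; [exact: idealM0 | exact: idealM_add|].
exact/idealM_mul/radical_stable.
Qed.

(** The ideal [a^s B], written as [B a^s]; the two agree because A is central in B. *)
Definition inv_ext (s : nat) : B -> Prop :=
  ext_l (fun a : A => inv_emb a) (idealX (inv_radical rho) s).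

Lemma inv_ext_coef s f g :
  inv_ext s f ->
  ext_r (@inv_val _ _ _ _ rho) (idealX (inv_radical rho) s) (f g).
Proof.
move: f; apply: idealM_ind => [|f f' hf hf'|f _ _ [a ha <-]].
- by rewrite skew0; apply: idealM0.
- by rewrite skewD; apply: idealM_add.
by rewrite skew_mul_emb gact_inv mulrC; apply: idealM_mul => //; exists a.
Qed.

Lemma inv_ext_submodule s : submodule (inv_ext s : (B^c)^o -> Prop).
Proof.
split; [exact: idealM0 | by move=> f g; apply: (@idealM_add B)|].
move=> f f'; change (inv_ext s (f : B) -> inv_ext s ((f : B) * (f' : B))).
move: f; apply: (@idealM_ind B) => [|f g hf hg|f _ _ [a ha <-]].
- by rewrite mul0r; apply: idealM0.
- by rewrite mulrDl; apply: (@idealM_add B).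
by rewrite -mulrA inv_emb_central mulrA; apply: idealM_mul => //; exists a.
Qed.

(** Cofinality applies to each coefficient of [f], and the central scalars from [a^s] then move to
    the right. *)
Lemma cofinal_skew :
  cofinal (@inv_val _ _ _ _ rho) (inv_radical rho) (radical rho) ->
  forall s, exists n, forall f, idealX (skew_radical rho) n f ->
    inv_ext s f.
Proof.
move=> [_ cof] s; have [n hn] := cof s; exists n => f /skew_radicalX hf.
rewrite (skew_decomp f); apply: big_ind => [||g _].
- exact: idealM0.
- exact: idealM_add.
move: (f g) (hn _ (hf g)); apply: idealM_ind.
- by rewrite rmorph0 mul0r; apply: idealM0.
- by move=> y z ? ?; rewrite rmorphD mulrDl; apply: idealM_add.
- move=> _ y [a ha <-] _; rewrite rmorphM -mulrA inv_emb_central.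
  by apply: idealM_mul => //; exists a.
Qed.

(** * The identification of the tensor product with Me *)

Lemma tincl_ract (M : rmodType B) (m : M) (f : B) :
  tincl (ract m f) = tpure m (skew_scale rho f (1 : R)) :> tensR M.
Proof.
by have [_ _ tb] := tpure_balanced M (skew_bimod rho); rewrite [LHS]tb.
Qed.

Lemma tproj_tincl (M : rmodType B) (m : M) : tproj (tincl m) = ract m e.
Proof. exact: tproj_pure. Qed.

(** This is the isomorphism of eBe with A: on Me, the element [e f e] acts as the invariant
    [reynolds (f 1)]. *)
Lemma tincl_tproj_ract (M : rmodType B) (u : tensR M) (f : B) :
  tincl (ract (tproj u) f) = ract u (reynolds rho (skew_scale rho f (1 : R))).
Proof.
move: u; apply: tens_ind => [|u v hu hv|m r].
- by rewrite tproj0 !ract0l tincl0.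
- by rewrite tprojD !ractDl tinclD hu hv.
rewrite tproj_pure ractA tincl_ract -(skew_scaleA rho) btens_pureZ; congr tpure.
rewrite /= /skew_scale mulr_sumr; apply: eq_bigr => g _.
by rewrite skewE mulrAC mulrA.
Qed.

Lemma tproj_ract (M : rmodType B) (u : tensR M) (a : A) :
  tproj (ract u a) = ract (tproj u) (inv_emb a).
Proof.
move: u; apply: tens_ind => [|u v hu hv|m r].
- by rewrite ract0l tproj0 ract0l.
- by rewrite tprojD !ractDl tprojD hu hv.
by rewrite tpure_inv !tproj_pure !ractA inv_emb_central.
Qed.

Lemma tincl_inv (M : rmodType B) (m : M) (a : A) :
  tincl (ract m (inv_emb a)) = ract (tincl m) a :> tensR M.
Proof. by rewrite tpure_inv. Qed.

Hypothesis noeR : right_noetherian R.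

Local Notation F := (qtensor_functor rho charG noeR).

Let noeB := @skew_noetherian _ _ _ _ rho noeR.
Let noeA := @invariants_noetherian _ _ _ _ rho charG noeR.

(** * Cofinality makes the functor fully faithful *)

Section Cofinal.
Hypothesis cof :
  cofinal (@inv_val _ _ _ _ rho) (inv_radical rho) (radical rho).

(* b is finitely generated and contained in BeB, so m b a^n B is contained in
   P for n large, and a power of b is contained in b a^n B. *)
Lemma torsion_mod_tincl (M : rmodType B) (P : M -> Prop) (m : M) :
  submodule P ->
  (forall f, exists n, forall a, idealX (inv_radical rho) n a ->
     P (tproj (ract (tincl (ract m f)) a))) ->
  torsion_mod (skew_radical rho) P m.
Proof.
move=> [P0 PD Pr] hm.
have [_ iD ir il] := skew_radical_ideal rho.
(* The property [T] holds on Be and passes to sums and right multiples, hence holds on b by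
   [skew_radical_trace]. *)
pose T (f : B) := exists n, forall a, idealX (inv_radical rho) n a ->
  P (ract m (f * inv_emb a)).
have {hm} TB : forall f, skew_radical rho f -> T f.
  apply: skew_radical_trace => [f f' [n hn] [n' hn']|f f' [n hn]|f].
  - exists (maxn n n') => a ha; rewrite mulrDl ractDr; apply: PD.
      exact/hn/(idealX_anti (inv_radical_ideal rho) (leq_maxl n n')).
    exact/hn'/(idealX_anti (inv_radical_ideal rho) (leq_maxr n n')).
  - exists n => a /hn h; rewrite -mulrA -inv_emb_central mulrA -ractA.
    exact: Pr.
  - have [n hn] := hm f; exists n => a /hn.
    by rewrite tproj_ract tproj_tincl !ractA mulrA.
(* Finitely many generators of b give one exponent for all of b. *)
have [n hn] : exists n, forall a, idealX (inv_radical rho) n a ->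
    forall f : B, skew_radical rho f -> P (ract m (f * inv_emb a)).
  have [|s [sB sS]] := @skew_noetherian _ _ _ _ rho noeR (skew_radical rho).
    by have [] := skew_radical_ideal rho; split.
  have [n hn] : exists n, {in s, forall f, forall a,
      idealX (inv_radical rho) n a -> P (ract m (f * inv_emb a))}.
    elim: s sB {sS} => [|f s IHs] sB; first by exists 0.
    have [n hn] := IHs (fun b bs => sB b (mem_behead (s := f :: s) bs)).
    have [n' hn'] := TB _ (sB f (mem_head f s)).
    exists (maxn n n') => b; rewrite inE => /predU1P[->|bs] a ha.
      exact/hn'/(idealX_anti (inv_radical_ideal rho) (leq_maxr n n')).
    exact/hn/(idealX_anti (inv_radical_ideal rho) (leq_maxl n n')).
  exists n => a ha f /sS[c ->]; rewrite mulr_suml ract_sumr big_seq.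
  apply: big_ind => // g gs; rewrite -mulrA -inv_emb_central mulrA -ractA.
  exact/Pr/hn.
(* The extra factor from b moves past the central scalar, so that [m] is multiplied by an element of
   [b a^n]. *)
have [j hj] := cofinal_skew cof n; exists j.+1; apply: idealM_ind.
- by rewrite ract0r.
- by move=> *; rewrite ractDr; apply: PD.
move=> f f' /hj + hf'; move: f; apply: idealM_ind.
- by rewrite mul0r ract0r.
- by move=> *; rewrite mulrDl ractDr; apply: PD.
move=> f _ _ [a ha <-]; rewrite -mulrA inv_emb_central mulrA.
exact/hn/il.
Qed.

Lemma torsion_tincl (M : rmodType B) (m : M) :
  (forall f, torsion (inv_radical rho) (tincl (ract m f))) ->
  torsion (skew_radical rho) m.
Proof.
move=> hm; apply: (@torsion_mod_tincl M (fun n => n = 0)).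
  by split=> [//|? ? -> ->|? ? ->]; rewrite ?addr0 ?ract0l.
by move=> f; have [n hn] := hm f; exists n => a /hn ->; rewrite tproj0.
Qed.


(** Since [f] and [g] are submodules, the hypothesis applies to all multiples of [m], [n] and [n'],
    as [torsion_tincl] requires. *)
Lemma qtensor_faithful : faithful F.
Proof.
move=> M N f g /(qeqP (inv_radical_ideal rho) noeA) fg.
apply/(qeqP (skew_radical_ideal rho) noeB) => m n n' hf hg.
apply: torsion_tincl => b.
rewrite ractDl ractN tinclD tinclN; apply: (fg (tincl (ract m b))).
  by apply/qtens_rel_pure/qrelZ.
by apply/qtens_rel_pure/qrelZ.
Qed.

Section Lift.
Variables (M N : rmodType B) (phi : qhom (inv_radical rho) (tensR M) (tensR N)).

(** The largest B-submodule of M x N that [tincl] carries into [phi]. *)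
Definition qtens_lift_rel (m : M) (n : N) : Prop :=
  forall f, phi (tincl (ract m f)) (tincl (ract n f)).

(** Multiplying by [f f'] and returning to the tensor product scales [u] and [v] by the same
    invariant, and [phi] is A-stable. *)
Lemma qtens_lift_rel_tproj u v f :
  phi u v -> qtens_lift_rel (ract (tproj u) f) (ract (tproj v) f).
Proof.
by move=> uv f'; rewrite !ractA !tincl_tproj_ract; apply: qrelZ.
Qed.

Lemma qtens_lift_rel0 : qtens_lift_rel 0 0.
Proof. by move=> f; rewrite !ract0l !tincl0; apply: qrel0. Qed.

Lemma qtens_lift_relD m m' n n' :
  qtens_lift_rel m n -> qtens_lift_rel m' n' ->
  qtens_lift_rel (m + m') (n + n').
Proof. by move=> h h' f; rewrite !ractDl !tinclD; apply: qrelD. Qed.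

Lemma qtens_lift_relZ m n f :
  qtens_lift_rel m n -> qtens_lift_rel (ract m f) (ract n f).
Proof. by move=> h f'; rewrite !ractA. Qed.

Lemma qtens_lift_rel_dom m :
  torsion_mod (skew_radical rho) (fun m' => exists n, qtens_lift_rel m' n) m.
Proof.
apply: torsion_mod_tincl => [|f].
  split; first by exists 0; apply: qtens_lift_rel0.
    by move=> m1 m2 [n1 h1] [n2 h2]; exists (n1 + n2); apply: qtens_lift_relD.
  by move=> m1 b [n h]; exists (ract n b); apply: qtens_lift_relZ.
(* A power of the ideal a moves [tincl (ract m f)] into the domain of [phi], and [tproj] carries
   that domain into the domain of the lift. *)
have [i hi] := qrel_dom phi (tincl (ract m f)); exists i => a /hi[v hv].
exists (tproj v); rewrite -[tproj _]ract1 -[tproj v]ract1.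
exact: qtens_lift_rel_tproj.
Qed.

Lemma qtens_lift_rel_ker n : qtens_lift_rel 0 n -> torsion (skew_radical rho) n.
Proof.
move=> h; apply: torsion_tincl => f.
by apply: (@qrel_ker _ _ _ _ phi); have := h f; rewrite ract0l tincl0.
Qed.

Definition qtens_lift : qhom (skew_radical rho) M N :=
  QHom qtens_lift_rel0 qtens_lift_relD qtens_lift_relZ qtens_lift_rel_dom
    qtens_lift_rel_ker.

End Lift.

Lemma qtensor_full : full F.
Proof.
move=> M N phi; exists (qtens_lift phi).
apply/(qeqP (inv_radical_ideal rho) noeA) => u v v' /qtens_rel_proj h.
(* Taking [f = 1] shows that the image of the lift is contained in [phi]. *)
apply: qrel_fun; have := h 1; rewrite !ract1 !(tprojK charG); exact.
Qed.

End Cofinal.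


(** * Essential surjectivity by induction along eB *)

Lemma inv_scaleA (a b : A) (r : inv_mod rho) :
  inv_scale a (inv_scale b r) = inv_scale (a * b) r.
Proof. by rewrite /inv_scale rmorphM mulrA. Qed.

Lemma inv_scale1 : left_id 1 (@inv_scale _ _ _ _ rho).
Proof. by move=> r; rewrite /inv_scale rmorph1 mul1r. Qed.

Lemma inv_scaleDr : right_distributive (@inv_scale _ _ _ _ rho) +%R.
Proof. by move=> a r s; apply: mulrDr. Qed.

Lemma inv_scaleDl (r : inv_mod rho) :
  {morph (@inv_scale _ _ _ _ rho)^~ r : a b / a + b}.
Proof. by move=> a b; rewrite /inv_scale rmorphD; apply: mulrDl. Qed.

HB.instance Definition _ := GRing.Zmodule_isLmodule.Build A (inv_mod rho)
  inv_scaleA inv_scale1 inv_scaleDr inv_scaleDl.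

(** Under [r |-> e r], this is right multiplication on eB: [e (r s) g = e g (g^-1 (r s))], and
    [e g = e]. *)
Definition inv_bract (r : inv_mod rho) (f : B) : inv_mod rho :=
  \sum_g rho g^-1%g ((r : R) * f g).

Lemma inv_bractA r (f f' : B) :
  inv_bract (inv_bract r f) f' = inv_bract r (f * f').
Proof.
rewrite /inv_bract.
under [RHS]eq_bigr => x _ do rewrite (skewM rho) mulr_sumr rmorph_sum.
rewrite exchange_big /=.
under [LHS]eq_bigr => h _ do rewrite mulr_suml rmorph_sum.
rewrite exchange_big /=; apply: eq_bigr => g _.
rewrite [RHS](reindex_inj (mulgI g)); apply: eq_bigr => h _ /=.
by rewrite mulKg invMg gactM mulrA [in RHS](rmorphM (rho g^-1%g)) gactVK.
Qed.

Definition inv_bimod : bimodule A B.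
Proof.
refine (@Bimodule A B (inv_mod rho) inv_bract _ _ _ inv_bractA _).
- move=> r s f; rewrite /inv_bract -big_split; apply: eq_bigr => g _.
  by rewrite mulrDl rmorphD.
- move=> r f f'; rewrite /inv_bract -big_split; apply: eq_bigr => g _.
  by rewrite skewD mulrDr rmorphD.
- move=> r; rewrite /inv_bract (bigD1 1%g) //= skewE eqxx invg1 gact1 mulr1.
  rewrite big1 ?addr0 // => g /negPf g1.
  by rewrite skewE g1 mulr0 rmorph0.
- move=> a r f; rewrite /inv_bract [RHS]mulr_sumr; apply: eq_bigr => g _.
  by rewrite -(gact_inv g^-1%g a) -rmorphM mulrA.
Defined.

(** Right multiplication by [e] projects eB onto eBe, that is, R onto A. *)
Lemma inv_bract_e (r : inv_mod rho) : inv_bract r e = inv_val (reynolds rho r).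
Proof.
rewrite /inv_bract /= /reynolds_val (reindex_inj invg_inj).
apply: eq_bigr => g _.
by rewrite invgK skewE mul1r rmorphM gact_alg.
Qed.

Let torsion0 (M : rmodType A) : torsion (inv_radical rho) (0 : M).
Proof. by exists 0 => a _; rewrite ract0l. Qed.

Section Object.
Variable N : rmodType A.
Local Notation indR := (btens N inv_bimod).

Definition ind_proj : indR -> N :=
  tlift (fun n (r : inv_mod rho) => ract n (reynolds rho r)).

Lemma ind_proj_balanced :
  balanced (fun (n : N) (r : inv_mod rho) => ract n (reynolds rho r)).
Proof.
split=> [n n' r|n r r'|n a r]; first by rewrite ractDl.
  by rewrite reynoldsD ractDr.
by rewrite ractA -reynoldsM.
Qed.

Definition ind_incl (n : N) : indR := tpure n (1 : inv_mod rho).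

Lemma ind_inclD (n n' : N) : ind_incl (n + n') = ind_incl n + ind_incl n'.
Proof. by case: (tpure_balanced N inv_bimod) => + _ _; apply. Qed.

Lemma ind_inclK (n : N) : ind_proj (ind_incl n) = n.
Proof.
rewrite [LHS](tlift_pure _ _ ind_proj_balanced).
rewrite -(rmorph1 (@inv_val _ _ _ _ rho)).
by rewrite (reynolds_id charG) ract1.
Qed.

Lemma ind_incl_inv (n : N) (a : A) :
  ind_incl (ract n a) = ract (ind_incl n) (inv_emb a).
Proof.
have [_ _ tb] := tpure_balanced N inv_bimod.
rewrite [LHS]tb btens_pureZ; congr tpure.
rewrite /= /inv_bract (bigD1 1%g) //= skewE eqxx invg1 gact1 mul1r.
rewrite big1 ?addr0 => [|g /negPf g1]; first exact: mulr1.
by rewrite skewE g1 mulr0 rmorph0.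
Qed.

(** Right multiplication by [e] makes the second factor invariant, and an invariant moves across the
    tensor sign into N. *)
Lemma ract_e_ind (u : indR) : exists n, ract u e = ind_incl n.
Proof.
move: u; apply: tens_ind => [|u v [n hn] [n' hn']|n r].
- exists 0; rewrite ract0l; apply: (addIr (ind_incl 0)).
  by rewrite -ind_inclD !add0r.
- by exists (n + n'); rewrite ractDl ind_inclD hn hn'.
exists (ract n (reynolds rho r)); have [_ _ tb] := tpure_balanced N inv_bimod.
rewrite btens_pureZ [RHS]tb; congr tpure.
by rewrite [LHS]inv_bract_e; apply/esym/mulr1.
Qed.

Lemma ind_incl_e (n : N) : ract (ind_incl n) e = ind_incl n.
Proof.
rewrite btens_pureZ; congr tpure; rewrite [LHS]inv_bract_e.
by rewrite -(rmorph1 (@inv_val _ _ _ _ rho)) (reynolds_id charG).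
Qed.

(** The graph of the isomorphism with N: both sides are compared inside [indR e]. The same relation,
    transposed, serves as the inverse. *)
Definition counit_rel (u : tensR indR) (n : N) : Prop := tproj u = ind_incl n.

Lemma counit_rel0 : counit_rel 0 0.
Proof.
rewrite /counit_rel tproj0.
by apply: (addIr (ind_incl 0)); rewrite -ind_inclD !add0r.
Qed.

Lemma counit_relD u u' n n' :
  counit_rel u n -> counit_rel u' n' -> counit_rel (u + u') (n + n').
Proof. by rewrite /counit_rel tprojD ind_inclD => -> ->. Qed.

Lemma counit_relZ u n a : counit_rel u n -> counit_rel (ract u a) (ract n a).
Proof. by rewrite /counit_rel tproj_ract ind_incl_inv => ->. Qed.

Lemma counit_rel_total u : exists n, counit_rel u n.
Proof.
have [n hn] := ract_e_ind (tproj u); exists n.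
by rewrite /counit_rel -hn -tproj_tincl (tprojK charG).
Qed.

Lemma counit_rel_surj n : exists u, counit_rel u n.
Proof.
by exists (tincl (ind_incl n)); rewrite /counit_rel tproj_tincl ind_incl_e.
Qed.

Lemma counit_rel_inj u u' n : counit_rel u n -> counit_rel u' n -> u = u'.
Proof. by move=> h h'; rewrite -[u](tprojK charG) h -h' (tprojK charG). Qed.

Lemma counit_rel_fun u n n' : counit_rel u n -> counit_rel u n' -> n = n'.
Proof. by move=> h h'; rewrite -[n]ind_inclK -h h' ind_inclK. Qed.

Definition counit : qhom (inv_radical rho) (tensR indR) N.
Proof.
apply: (QHom counit_rel0 counit_relD counit_relZ) => [u|n hn].
  by exists 0 => a _; apply: counit_rel_total.
by rewrite (counit_rel_fun hn counit_rel0).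
Defined.

Definition counit_inv : qhom (inv_radical rho) N (tensR indR).
Proof.
apply: (@QHom _ _ _ _ (fun n u => counit_rel u n)) => [|n n' u u'|n u a|n|u hu].
- exact: counit_rel0.
- exact: counit_relD.
- exact: counit_relZ.
- by exists 0 => a _; apply: counit_rel_surj.
- by rewrite (counit_rel_inj hu counit_rel0).
Defined.

End Object.

Lemma qtensor_essentially_surjective : essentially_surjective F.
Proof.
move=> N; exists (btens N inv_bimod : rmodType B), (counit N), (counit_inv N).
split; apply/(qeqP (inv_radical_ideal rho) noeA).
  move=> u v v' [n [un vn]] ->; rewrite (counit_rel_inj un vn) subrr.
  exact: torsion0.
move=> n m m' [u [un um]] ->; rewrite (counit_rel_fun un um) subrr.
exact: torsion0.
Qed.

(** * Faithfulness implies cofinality *)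

Lemma faithful_cofinal : faithful F ->
  cofinal (@inv_val _ _ _ _ rho) (inv_radical rho) (radical rho).
Proof.
move=> faithF; split=> [x|s].
  by split; apply: idealM_ind; try exact: idealM0; try exact: idealM_add;
    move=> y z hy hz; rewrite mulrC; apply: idealM_mul.
(* [Q] is [B/a^s B], and [p 1] is the class of 1. *)
have [Q [p [p_surj p_ker]]] := quotient_module (inv_ext_submodule s).
have Qs (q : Q) a : idealX (inv_radical rho) s a -> ract q (inv_emb a) = 0.
  move=> ha; have [f <-] := p_surj q; rewrite /ract -linearZ; apply/p_ker.
  by apply: idealM_mul => //; exists a.
have [n hn] : torsion (skew_radical rho) (p 1).
  (* The identity and zero maps of [Q] agree after applying the functor, because [a^s] kills the
     tensor product. Faithfulness makes them agree before, so [p 1] is b-torsion. *)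
  have /(qeqP (skew_radical_ideal rho) noeB)/(_ (p 1) (p 1) 0) h :
      heq (idm (Q : QModB rho noeR))
        (qlin (skew_radical_ideal rho) (\0 : {linear Q -> Q})).
    apply: faithF; apply/(qeqP (inv_radical_ideal rho) noeA) => u v w _ _.
    exists s => a ha; rewrite -[v - w](tprojK charG) -tincl_inv.
    by rewrite Qs ?tincl0.
  by rewrite -[p 1]subr0; apply: h.
exists n => x hx.
(* An element of [r^n] embeds into [b^n], hence into [a^s B]; its coefficient at 1 then lies in
   [a^s R]. *)
have /hn : idealX (skew_radical rho) n (emb x).
  apply: (idealX_morph (f := @skew_emb R gT : {rmorphism R -> B})) hx => y hy g.
  by have [r0 _ _ _] := radical_ideal rho; rewrite skewE; case: eqP.
rewrite /ract -linearZ => /p_ker /(inv_ext_coef 1%g) /=.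
by rewrite [_ *: _]mul1r skewE eqxx.
Qed.

End Morita.

Theorem theorem6p6 (k : fieldType) (R : comPzRingType) (eta : {rmorphism k -> R})
    (gT : finGroupType) (rho : algebra_action eta gT)
    (noeR : right_noetherian R)
    (ntG : (1 < #|[set: gT]|)%N)
    (charG : [pchar k]^'.-nat #|[set: gT]|) :
  is_equivalence (qtensor_functor rho charG noeR) <->
  cofinal (@inv_val _ _ _ _ rho) (inv_radical rho) (radical rho).
Proof.
split=> [/equivalence_faithful/faithful_cofinal //|cof].
apply: fully_faithful_equivalence.
- exact: qtensor_faithful.
- exact: qtensor_full.
- exact: qtensor_essentially_surjective.
Qed.
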